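(* Let $R$ be a ring and let $\mathcal B$ be a class of right $R$-modules closed under direct limits and products. Let $\overline{\mathcal B}$ denote the definable closure of $\mathcal B$. Then each module from ${}^\perp\mathcal B$ is $(\overline{\mathcal B},\lambda)$-projective for every regular uncountable cardinal $\lambda$. Consequently, ${}^\perp\mathcal B={}^\perp\overline{\mathcal B}$.
   Context: $R$ is an associative unital ring; modules are right $R$-modules. For a class $\mathcal C$ of modules, ${}^\perp\mathcal C=\{M : \operatorname{Ext}^1_R(M,C)=0 \text{ for all } C\in\mathcal C\}$. A class of modules is definable if it is closed under products, direct limits and pure submodules; the definable closure of $\mathcal C$ is the smallest definable class containing $\mathcal C$. A module is $<\lambda$-presented if it is the cokernel of a homomorphism between free modules of rank $<\lambda$. A homomorphism $f\colon M\to N$ is $\mathcal C$-injective if $\operatorname{Hom}_R(f,C)\colon \operatorname{Hom}_R(N,C)\to\operatorname{Hom}_R(M,C)$ is surjective for all $C\in\mathcal C$. For a regular uncountable cardinal $\lambda$, a directed system $(M_i,f_{ji}\colon M_i\to M_j\mid i<j\in I)$ of modules is $\lambda$-continuous if the poset $(I,\le)$ has suprema of all chains of length $<\lambda$ and, for any such chain $J\subseteq I$, $M_{\sup J}=\varinjlim_{j\in J}M_j$. A module $M$ is almost $(\mathcal C,\lambda)$-projective if it is the direct limit of a $\lambda$-continuous directed system consisting of $<\lambda$-presented modules from ${}^\perp\mathcal C$; if moreover all the colimit maps (from the members of the system to $M$) are $\mathcal C$-injective, then $M$ is called $(\mathcal C,\lambda)$-projective. *)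

(* Defs.v *)
From HB Require Import structures.
From mathcomp Require Import all_boot all_order all_algebra.
From mathcomp Require Import boolp classical_sets functions cardinality.

Set Implicit Arguments.
Unset Strict Implicit.
Unset Printing Implicit Defensive.

Import Order.TTheory GRing.Theory.
Local Open Scope classical_set_scope.
Local Open Scope card_scope.
Local Open Scope ring_scope.

(* Right R-modules are left modules over the opposite ring R^c: for r : R^c,
   r *: x is the right action x . r of r : R. *)
Notation rmodType R := (lmodType R^c).

(* A cardinal is represented by any type having that cardinality. *)
Definition card_lt T U (A : set T) (B : set U) : Prop :=
  (A #<= B) /\ ~ (B #<= A).

Definition uncountable_cardinal (L : Type) : Prop := ~ countable [set: L].

Definition regular_cardinal (L : Type) : Prop :=
  infinite_set [set: L] /\
  forall (J : set L) (F : L -> set L),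
    card_lt J [set: L] -> (forall j, J j -> card_lt (F j) [set: L]) ->
    \bigcup_(j in J) F j <> [set: L].

Section Modules.
Variable R : pzRingType.
Implicit Types (M N C : rmodType R) (D : rmodType R -> Prop).

Definition is_exact M N C (f : {linear M -> N}) (g : {linear N -> C}) : Prop :=
  forall y, g y = 0 <-> exists x, f x = y.

Definition is_surjective M N (f : {linear M -> N}) : Prop :=
  forall y, exists x, f x = y.

(* Elements of the Yoneda group Ext^1_R(M, C) are represented by extensions
   0 -> C -> E -> M -> 0, up to equivalence of extensions; the zero element is
   the class of the direct sum. *)
Record extension M C := Extension {
  ext_mid :> rmodType R;
  ext_in : {linear C -> ext_mid};
  ext_out : {linear ext_mid -> M};
  ext_in_inj : injective ext_in;
  ext_out_surj : is_surjective ext_out;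
  ext_exact : is_exact ext_in ext_out }.

Definition ext_equiv M C (E E' : extension M C) : Prop :=
  exists phi : {linear E -> E'},
    (forall x, phi (ext_in E x) = ext_in E' x) /\
    (forall y, ext_out E' (phi y) = ext_out E y).

Definition inl_mod M C (x : C) : (C * M)%type := (x, 0).

Fact inl_mod_is_linear M C : linear (@inl_mod M C).
Proof. by move=> a x y; congr pair; rewrite /= scaler0 addr0. Qed.

HB.instance Definition _ M C :=
  GRing.isLinear.Build R^c C (C * M)%type *:%R (@inl_mod M C)
    (@inl_mod_is_linear M C).

Fact inl_mod_inj M C : injective (@inl_mod M C).
Proof. by move=> x y []. Qed.

Fact snd_mod_surj M C : is_surjective (snd : {linear (C * M)%type -> M}).
Proof. by move=> y; exists (0, y). Qed.

Fact inl_snd_exact M C :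
  is_exact (@inl_mod M C : {linear C -> (C * M)%type})
           (snd : {linear (C * M)%type -> M}).
Proof.
move=> [x y] /=; split=> [->|[z [_ <-]]] //.
by exists x.
Qed.

Definition ext0 M C : extension M C :=
  Extension (@inl_mod_inj M C) (@snd_mod_surj M C) (@inl_snd_exact M C).

Definition Ext1_vanishes M C : Prop :=
  forall E : extension M C, ext_equiv E (ext0 M C).

Definition left_perp D M : Prop := forall C, D C -> Ext1_vanishes M C.

Definition is_product (I : Type) (F : I -> rmodType R) (P : rmodType R)
    (p : forall i, {linear P -> F i}) : Prop :=
  forall N (g : forall i, {linear N -> F i}),
    exists h : {linear N -> P},
      (forall i x, p i (h x) = g i x) /\
      forall h' : {linear N -> P},
        (forall i x, p i (h' x) = g i x) -> h' =1 h.

Definition closed_products D : Prop :=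
  forall (I : Type) (F : I -> rmodType R) (P : rmodType R)
         (p : forall i, {linear P -> F i}),
    is_product p -> (forall i, D (F i)) -> D P.

Definition directed_poset d (I : porderType d) : Prop :=
  inhabited I /\ forall i j : I, exists k : I, (i <= k)%O /\ (j <= k)%O.

Record poset_system d (I : porderType d) := PosetSystem {
  sys_obj :> I -> rmodType R;
  sys_map : forall i j : I, (i <= j)%O -> {linear sys_obj i -> sys_obj j};
  sys_map_id : forall i (le_ii : (i <= i)%O) x, sys_map le_ii x = x;
  sys_map_comp : forall i j k (le_ij : (i <= j)%O) (le_jk : (j <= k)%O)
      (le_ik : (i <= k)%O) x,
    sys_map le_jk (sys_map le_ij x) = sys_map le_ik x }.

(* Cocones and colimits are taken along the restriction of the system to a
   subset J of the poset. *)
Definition is_cocone d (I : porderType d) (S : poset_system I) (J : set I)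
    N (c : forall i, J i -> {linear S i -> N}) : Prop :=
  forall i j (Ji : J i) (Jj : J j) (le_ij : (i <= j)%O) x,
    c j Jj (sys_map S le_ij x) = c i Ji x.

Definition is_colimit d (I : porderType d) (S : poset_system I) (J : set I)
    N (c : forall i, J i -> {linear S i -> N}) : Prop :=
  is_cocone c /\
  forall N' (g : forall i, J i -> {linear S i -> N'}), is_cocone g ->
    exists h : {linear N -> N'},
      (forall i (Ji : J i) x, h (c i Ji x) = g i Ji x) /\
      forall h' : {linear N -> N'},
        (forall i (Ji : J i) x, h' (c i Ji x) = g i Ji x) -> h' =1 h.

Definition is_direct_limit d (I : porderType d) (S : poset_system I) N
    (c : forall i, {linear S i -> N}) : Prop :=
  is_colimit (J := [set: I]) (fun i _ => c i).

Definition closed_direct_limits D : Prop :=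
  forall d (I : porderType d) (S : poset_system I) N
         (c : forall i, {linear S i -> N}),
    directed_poset I -> is_direct_limit c -> (forall i, D (S i)) -> D N.

(* Purity: a finite system of linear equations with constants in M that is
   solvable in N is solvable in M. *)
Definition is_pure_mono M N (f : {linear M -> N}) : Prop :=
  injective f /\
  forall (m n : nat) (r : 'M[R^c]_(m, n)) (a : 'I_n -> M),
    (exists y : 'I_m -> N, forall j, \sum_i r i j *: y i = f (a j)) ->
    exists x : 'I_m -> M, forall j, \sum_i r i j *: x i = a j.

Definition closed_pure_submodules D : Prop :=
  forall M N (f : {linear M -> N}), is_pure_mono f -> D N -> D M.

Definition definable D : Prop :=
  [/\ closed_products D, closed_direct_limits D & closed_pure_submodules D].

Definition definable_closure D M : Prop :=
  forall D', definable D' -> (forall N, D N -> D' N) -> D' M.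

Definition is_basis (X : Type) (F : rmodType R) (b : X -> F) : Prop :=
  forall N (g : X -> N),
    exists h : {linear F -> N},
      (forall x, h (b x) = g x) /\
      forall h' : {linear F -> N}, (forall x, h' (b x) = g x) -> h' =1 h.

Definition free_lt (L : Type) (F : rmodType R) : Prop :=
  exists (X : Type) (b : X -> F),
    is_basis b /\ card_lt [set: X] [set: L].

Definition presented_lt (L : Type) M : Prop :=
  exists (F G : rmodType R) (f : {linear F -> G}) (p : {linear G -> M}),
    [/\ free_lt L F, free_lt L G, is_exact f p & is_surjective p].

Definition class_injective D M N (f : {linear M -> N}) : Prop :=
  forall C, D C -> forall g : {linear M -> C},
    exists h : {linear N -> C}, forall x, h (f x) = g x.

Definition is_chain_lt (L : Type) d (I : porderType d) (J : set I) : Prop :=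
  [/\ J !=set0, total_on J (fun i j => (i <= j)%O) & card_lt J [set: L]].

Definition lambda_continuous (L : Type) d (I : porderType d)
    (S : poset_system I) : Prop :=
  forall J : set I, is_chain_lt L J ->
    exists (s : I) (sup_s : supremums J s),
      is_colimit (fun i (Ji : J i) => sys_map S (proj1 sup_s i Ji)).

Definition class_projective D (L : Type) M : Prop :=
  exists (d : Order.disp_t) (I : porderType d) (S : poset_system I)
         (c : forall i, {linear S i -> M}),
    [/\ directed_poset I /\ lambda_continuous L S,
        forall i, presented_lt L (S i) /\ left_perp D (S i),
        is_direct_limit c
      & forall i, class_injective D (c i)].

End Modules.

(* Main.v *)
(** Present [M] as [F / K] with [F] free on [X], so that [Ext^1(M, C) = 0]
    means that every map from [K] to [C] extends to [F]. For a set [A] of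
    generators and relations, suppose that some [f : K -> C_A], with [C_A] in
    [B], kills the relations in [A] but has no extension to [F] killing the
    generators in [A]. Choosing such a map for every bad [A] gives one map
    from [K] to the submodule of the product of all the [C_A] of the families
    vanishing at every [A] that contains some finite set; this submodule is a
    direct limit of products, hence in [B]. The map extends to [F], and
    the extension kills each generator [x] at every [A] containing some finite
    set [phi x]. So no [phi]-closed [A] is bad, whatever its cardinality.
    The same argument with the quotient of the product makes the modules
    presented by closed sets orthogonal to [B]. The small closed sets form the
    required system.

    The definable closure of [B] consists of pure submodules [N] of modules
    [C] in [B]. To extend [f : K -> N] to [F], proceed along closed sets,
    adding one countable orbit of [phi] at a time: along an orbit, the maps
    into [C] satisfy a Mittag-Leffler condition, again by the product
    argument, and purity replaces each of the countably many finite stages by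
    a map into [N]. *)

From HB Require Import structures.
Require Import Defs.
From mathcomp Require Import all_boot all_order all_algebra.
From mathcomp Require Import boolp classical_sets cardinality.

Set Implicit Arguments.
Unset Strict Implicit.
Unset Printing Implicit Defensive.

Import Order.TTheory GRing.Theory.
Local Open Scope classical_set_scope.
Local Open Scope card_scope.
Local Open Scope ring_scope.

Definition linear_of (S : pzRingType) (V W : lmodType S) (f : V -> W)
    (f_lin : linear f) : {linear V -> W} :=
  HB.pack f (GRing.isLinear.Build S V W *:%R f f_lin).

(** * Submodules, quotients and products *)

Record submodule (S : pzRingType) (V : lmodType S) := Submodule {
  submodule_set :> V -> Prop;
  submodule0 : submodule_set 0;
  submoduleP : forall a x y, submodule_set x -> submodule_set y ->
    submodule_set (a *: x + y) }.

Definition submodule_of (S : pzRingType) (V : lmodType S) (P : V -> Prop)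
    (P_submod : P 0 /\ forall a x y, P x -> P y -> P (a *: x + y)) :
  submodule V := Submodule P_submod.1 P_submod.2.

Section SubmoduleTheory.
Variables (S : pzRingType) (V : lmodType S) (U : submodule V).

Lemma submoduleD x y : U x -> U y -> U (x + y).
Proof. by move=> Ux Uy; rewrite -[x]scale1r; apply: submoduleP. Qed.

Lemma submoduleZ a x : U x -> U (a *: x).
Proof.
by move=> Ux; rewrite -[_ *: _]addr0; apply: submoduleP => //; apply: submodule0.
Qed.

Lemma submoduleN x : U x -> U (- x).
Proof. by rewrite -scaleN1r; apply: submoduleZ. Qed.

Definition submodule_pred : {pred V} := fun x => `[< U x >].

Lemma submodule_pred_closed : submod_closed submodule_pred.
Proof.
split; first exact/asboolP/(submodule0 U).
move=> a x y /asboolP Ux /asboolP Uy; apply/asboolP.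
exact: submoduleP.
Qed.

HB.instance Definition _ :=
  GRing.isSubmodClosed.Build S V submodule_pred submodule_pred_closed.

Definition subm := {x : V | x \in submodule_pred}.
HB.instance Definition _ := SubChoice.on subm.
HB.instance Definition _ := [SubChoice_isSubLmodule of subm by <:].

Lemma submP (x : subm) : U (val x).
Proof. exact/asboolP/(valP x). Qed.

Definition to_subm x (Ux : U x) : subm := exist _ x (asboolT Ux).

Fact corestrict_linear (W : lmodType S) (f : {linear W -> V})
  (fU : forall x, U (f x)) : linear (fun x => to_subm (fU x)).
Proof. by move=> a x y; apply: val_inj; rewrite /= linearP. Qed.

(** The result of [choose] depends only on the predicate and not on the witness [x], so congruent
    elements get the same representative. The quotient can then be a subtype: the elements that
    represent themselves. *)
Definition coset_rep (x : V) : V := choose (fun y => `[< U (y - x) >]) x.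

Lemma coset_rep_sub x : U (coset_rep x - x).
Proof.
apply/asboolP; apply: (@chooseP _ (fun y => `[< U (y - x) >])).
by apply/asboolP; rewrite subrr; apply: submodule0.
Qed.

Lemma coset_repE x y : U (x - y) -> coset_rep x = coset_rep y.
Proof.
move=> Uxy; rewrite /coset_rep.
have eqP z : `[< U (z - x) >] = `[< U (z - y) >].
  apply/asboolP/asboolP => Uz; first by rewrite -(subrKA x); apply: submoduleD.
  rewrite -(subrKA y); apply: submoduleD => //.
  by rewrite -opprB; apply: submoduleN.
rewrite (eq_choose eqP); apply: choose_id; apply/asboolP => //.
by rewrite subrr; apply: submodule0.
Qed.

Definition quot := {x : V | coset_rep x == x}.
HB.instance Definition _ := SubChoice.on quot.

Lemma coset_rep_id x : coset_rep (coset_rep x) == coset_rep x.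
Proof. by apply/eqP/coset_repE/coset_rep_sub. Qed.

Definition coset (x : V) : quot := exist _ (coset_rep x) (coset_rep_id x).

Lemma cosetP x y : coset x = coset y <-> U (x - y).
Proof.
split=> [[] eq_xy|Uxy]; last by apply: val_inj; apply: coset_repE.
rewrite -(subrKA (coset_rep y)) -{1}eq_xy.
apply: submoduleD; last exact: coset_rep_sub.
by rewrite -opprB; apply/submoduleN/coset_rep_sub.
Qed.

Lemma coset_val x : coset (val x) = x.
Proof. by apply: val_inj => /=; apply/eqP; exact: (valP x). Qed.

Lemma coset_surj (y : quot) : exists x, coset x = y.
Proof. by exists (val y); apply: coset_val. Qed.

Let q0 : quot := coset 0.
Let qopp (x : quot) : quot := coset (- val x).
Let qadd (x y : quot) : quot := coset (val x + val y).
Let qscale a (x : quot) : quot := coset (a *: val x).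

Let cosetD x y : qadd (coset x) (coset y) = coset (x + y).
Proof.
rewrite /qadd; apply/cosetP; rewrite opprD addrACA.
by apply: submoduleD; apply: coset_rep_sub.
Qed.
Let cosetN x : qopp (coset x) = coset (- x).
Proof.
by apply/cosetP; rewrite -opprD; apply/submoduleN/coset_rep_sub.
Qed.
Let cosetZ a x : qscale a (coset x) = coset (a *: x).
Proof.
by apply/cosetP; rewrite -scalerBr; apply/submoduleZ/coset_rep_sub.
Qed.

Let qaddA : associative qadd.
Proof.
move=> x y z; rewrite -(coset_val x) -(coset_val y) -(coset_val z).
by rewrite !cosetD addrA.
Qed.
Let qaddC : commutative qadd.
Proof. by move=> x y; rewrite /qadd addrC. Qed.
Let qadd0 : left_id q0 qadd.
Proof. by move=> x; rewrite -(coset_val x) cosetD add0r. Qed.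
Let qaddN : left_inverse q0 qopp qadd.
Proof. by move=> x; rewrite -(coset_val x) cosetN cosetD addNr. Qed.

HB.instance Definition _ :=
  GRing.isZmodule.Build quot qaddA qaddC qadd0 qaddN.

Let cosetDE x y : coset x + coset y = coset (x + y).
Proof. exact: cosetD. Qed.

Let qscaleA a b x : qscale a (qscale b x) = qscale (a * b) x.
Proof. by rewrite -(coset_val x) !cosetZ scalerA. Qed.
Let qscale1 : left_id 1 qscale.
Proof. by move=> x; rewrite -(coset_val x) cosetZ scale1r. Qed.
Let qscaleDr : right_distributive qscale +%R.
Proof.
move=> a x y; rewrite -(coset_val x) -(coset_val y) cosetDE !cosetZ.
by rewrite cosetDE scalerDr.
Qed.
Let qscaleDl x : {morph qscale^~ x : a b / a + b}.
Proof.
by move=> a b; rewrite -(coset_val x) !cosetZ cosetDE scalerDl.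
Qed.

HB.instance Definition _ :=
  GRing.Zmodule_isLmodule.Build S quot qscaleA qscale1 qscaleDr qscaleDl.

Lemma coset_linear : linear coset.
Proof. by move=> a x y; rewrite -cosetD -cosetZ. Qed.

End SubmoduleTheory.

Definition corestrict (S : pzRingType) (V W : lmodType S) (U : submodule V)
    (f : {linear W -> V}) (fU : forall x, U (f x)) : {linear W -> subm U} :=
  linear_of (corestrict_linear fU).

Lemma factor_surj (S : pzRingType) (V Q W : lmodType S) (p : {linear V -> Q})
    (f : {linear V -> W}) :
  (forall y, exists x, p x = y) -> (forall x, p x = 0 -> f x = 0) ->
  exists g : {linear Q -> W}, forall x, g (p x) = f x.
Proof.
move=> /choice[lift liftP] fK; pose g y := f (lift y).
have gE x : g (p x) = f x.
  by apply/eqP; rewrite -subr_eq0 -linearB fK // linearB liftP subrr.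
have g_lin : linear g.
  by move=> a x y; rewrite -(liftP x) -(liftP y) -linearP !gE linearP.
by exists (linear_of g_lin).
Qed.

Section QuotientTheory.
Variables (S : pzRingType) (V : lmodType S) (U : submodule V).
Local Notation quot := (quot U).
Local Notation coset := (coset U).

HB.instance Definition _ := GRing.isLinear.Build S V quot *:%R coset (@coset_linear _ _ U).

Lemma coset_eq0 x : coset x = 0 <-> U x.
Proof. by rewrite -(linear0 coset) cosetP subr0. Qed.

Lemma quot_lift (W : lmodType S) (f : {linear V -> W}) :
  (forall x, U x -> f x = 0) ->
  exists g : {linear quot -> W}, forall x, g (coset x) = f x.
Proof.
by move=> fU; apply: factor_surj => [|x /coset_eq0]; [apply: coset_surj|apply: fU].
Qed.

End QuotientTheory.

Fact preim_submod (S : pzRingType) (V W : lmodType S)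
    (f : {linear V -> W}) (U : submodule W) :
  U (f 0) /\ forall a x y, U (f x) -> U (f y) -> U (f (a *: x + y)).
Proof.
split=> [|a x y]; first by rewrite linear0; apply: submodule0.
by rewrite linearP; apply: submoduleP.
Qed.

Definition preim_submodule (S : pzRingType) (V W : lmodType S)
    (f : {linear V -> W}) (U : submodule W) : submodule V :=
  submodule_of (preim_submod f U).

Fact ker_submod (S : pzRingType) (V W : lmodType S) (f : {linear V -> W}) :
  f 0 = 0 /\ forall a x y, f x = 0 -> f y = 0 -> f (a *: x + y) = 0.
Proof.
by split=> [|a x y fx fy]; rewrite ?linear0 // linearP fx fy scaler0 addr0.
Qed.

Definition ker_submodule (S : pzRingType) (V W : lmodType S)
    (f : {linear V -> W}) : submodule V :=
  submodule_of (ker_submod f).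

(** Intersection of the submodules containing [X]: to prove a property on a span, apply membership
    to the submodule of elements that have it. *)
Definition in_span (S : pzRingType) (V : lmodType S) (X : set V) (x : V) :=
  forall U : submodule V, (forall y, X y -> U y) -> U x.

Fact span_submod (S : pzRingType) (V : lmodType S) (X : set V) :
  in_span X 0 /\
  forall a x y, in_span X x -> in_span X y -> in_span X (a *: x + y).
Proof.
split=> [U _|a x y xX yX U XU]; first exact: submodule0.
by apply: submoduleP; [apply: xX|apply: yX].
Qed.

Definition span (S : pzRingType) (V : lmodType S) (X : set V) : submodule V :=
  submodule_of (span_submod X).

Lemma span_sub (S : pzRingType) (V : lmodType S) (X : set V) : X `<=` span X.
Proof. by move=> x Xx U; apply. Qed.

Lemma span_min (S : pzRingType) (V : lmodType S) (X : set V) (U : submodule V) :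
  (forall x, X x -> U x) -> forall x, span X x -> U x.
Proof. by move=> XU x; apply. Qed.

Section DependentProducts.
Variables (S : pzRingType) (J : Type) (B : J -> lmodType S).

Definition dprod := forall j, B j.
HB.instance Definition _ := gen_eqMixin dprod.
HB.instance Definition _ := gen_choiceMixin dprod.

Let d0 : dprod := fun j => 0.
Let dopp (x : dprod) : dprod := fun j => - x j.
Let dadd (x y : dprod) : dprod := fun j => x j + y j.
Let dscale a (x : dprod) : dprod := fun j => a *: x j.

Lemma dprod_ext (x y : dprod) : (forall j, x j = y j) -> x = y.
Proof. exact: functional_extensionality_dep. Qed.

Let daddA : associative dadd.
Proof. by move=> x y z; apply: dprod_ext => j; apply: addrA. Qed.
Let daddC : commutative dadd.
Proof. by move=> x y; apply: dprod_ext => j; apply: addrC. Qed.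
Let dadd0 : left_id d0 dadd.
Proof. by move=> x; apply: dprod_ext => j; apply: add0r. Qed.
Let daddN : left_inverse d0 dopp dadd.
Proof. by move=> x; apply: dprod_ext => j; apply: addNr. Qed.

HB.instance Definition _ :=
  GRing.isZmodule.Build dprod daddA daddC dadd0 daddN.

Let dscaleA a b x : dscale a (dscale b x) = dscale (a * b) x.
Proof. by apply: dprod_ext => j; apply: scalerA. Qed.
Let dscale1 : left_id 1 dscale.
Proof. by move=> x; apply: dprod_ext => j; apply: scale1r. Qed.
Let dscaleDr : right_distributive dscale +%R.
Proof. by move=> a x y; apply: dprod_ext => j; apply: scalerDr. Qed.
Let dscaleDl x : {morph dscale^~ x : a b / a + b}.
Proof. by move=> a b; apply: dprod_ext => j; apply: scalerDl. Qed.

HB.instance Definition _ :=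
  GRing.Zmodule_isLmodule.Build S dprod dscaleA dscale1 dscaleDr dscaleDl.

End DependentProducts.

Section DependentProductTheory.
Variables (S : pzRingType) (J : Type) (B : J -> lmodType S).
Local Notation dprod := (dprod B).

Lemma dprodDE (x y : dprod) j : (x + y) j = x j + y j. Proof. by []. Qed.
Lemma dprodNE (x : dprod) j : (- x) j = - x j. Proof. by []. Qed.
Lemma dprodZE a (x : dprod) j : (a *: x) j = a *: x j. Proof. by []. Qed.
Lemma dprod0E j : (0 : dprod) j = 0. Proof. by []. Qed.
Definition dprodE := (dprodDE, dprodNE, dprodZE, dprod0E).

Definition dproj j (x : dprod) : B j := x j.

Lemma dproj_linear j : linear (dproj j). Proof. by []. Qed.

HB.instance Definition _ j :=
  GRing.isLinear.Build S dprod (B j) *:%R (dproj j) (dproj_linear j).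

Definition dpair (V : lmodType S) (f : forall j, {linear V -> B j}) (x : V) :
  dprod := fun j => f j x.

Lemma dpair_linear V f : linear (@dpair V f).
Proof. by move=> a x y; apply: dprod_ext => j; rewrite /dpair linearP. Qed.

HB.instance Definition _ V f :=
  GRing.isLinear.Build S V dprod *:%R (@dpair V f) (dpair_linear f).

Fact supported_submod (W : set J) :
  (forall j, ~ W j -> (0 : dprod) j = 0) /\
  forall a (x y : dprod), (forall j, ~ W j -> x j = 0) ->
    (forall j, ~ W j -> y j = 0) -> forall j, ~ W j -> (a *: x + y) j = 0.
Proof.
split=> // a x y xW yW j Wj.
by rewrite !dprodE xW // yW // scaler0 addr0.
Qed.

Definition supported_in (W : set J) : submodule dprod :=
  submodule_of (supported_submod W).

Definition truncate (W : set J) (x : dprod) : dprod :=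
  fun j => if pselect (W j) then x j else 0.

Lemma truncate_linear W : linear (truncate W).
Proof.
move=> a x y; apply: dprod_ext => j; rewrite !dprodE /truncate.
by case: (pselect (W j)) => ? /=; rewrite ?scaler0 ?addr0.
Qed.

HB.instance Definition _ W :=
  GRing.isLinear.Build S dprod dprod *:%R (truncate W) (truncate_linear W).

Lemma truncate_supported W x : supported_in W (truncate W x).
Proof. by move=> j Wj; rewrite /truncate; case: (pselect (W j)). Qed.

End DependentProductTheory.

(** * Free modules *)

Section FreeModules.
Variables (S : pzRingType) (X : choiceType).

Definition has_finite_support (u : dprod (fun _ : X => S^o)) :=
  exists s : seq X, forall x, u x != 0 -> x \in s.

Fact finite_support_submod :
  has_finite_support 0 /\
  forall a u v, has_finite_support u -> has_finite_support v ->
    has_finite_support (a *: u + v).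
Proof.
split=> [|a u v [s us] [t vt]]; first by exists [::] => x; rewrite eqxx.
exists (s ++ t) => x; rewrite mem_cat.
have [u0|/us->//] := eqVneq (u x) 0.
have [v0|/vt->] := eqVneq (v x) 0; last by rewrite orbT.
by rewrite !dprodE u0 v0 scaler0 addr0 eqxx.
Qed.

Definition finitely_supported : submodule (dprod (fun _ : X => S^o)) :=
  submodule_of finite_support_submod.

Definition free : lmodType S := subm finitely_supported.

Definition coef (v : free) (x : X) : S := val (v : subm finitely_supported) x.

Lemma coefP a u v x : coef (a *: u + v) x = a * coef u x + coef v x.
Proof. by []. Qed.

Lemma free_eqP (u v : free) : (forall x, coef u x = coef v x) -> u = v.
Proof. by move=> uv; apply/val_inj/dprod_ext. Qed.

Fact supp_key (v : free) : {s : seq X | forall x, coef v x != 0 -> x \in s}.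
Proof. exact: cid (submP (v : subm finitely_supported)). Qed.

(** A chosen finite list covering the support; it may also contain points where the coefficient is
    0, which contribute nothing to sums. *)
Definition supp (v : free) : seq X := undup (sval (supp_key v)).

Lemma supp_uniq v : uniq (supp v). Proof. exact: undup_uniq. Qed.

Lemma suppP v x : coef v x != 0 -> x \in supp v.
Proof. by rewrite mem_undup; apply: (svalP (supp_key v)). Qed.

Fact gen_key (x : X) :
  finitely_supported ((fun y => if y == x then 1 else 0) :
                        dprod (fun _ : X => S^o)).
Proof.
by exists [:: x] => y; rewrite inE; case: (y == x) => //; rewrite eqxx.
Qed.

Definition gen (x : X) : free := to_subm (gen_key x).

Lemma coef_gen x y : coef (gen x) y = if y == x then 1 else 0.
Proof. by []. Qed.

Lemma sum_subset (N : nmodType) (s t : seq X) (F : X -> N) :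
  uniq s -> uniq t -> {subset s <= t} ->
  (forall x, x \notin s -> F x = 0) ->
  \sum_(x <- s) F x = \sum_(x <- t) F x.
Proof.
move=> Us Ut st F0; rewrite [RHS](bigID (mem s)) /= [X in _ + X]big1.
  rewrite addr0 -[RHS]big_filter; apply: perm_big; apply: uniq_perm => //.
    exact: filter_uniq.
  move=> x; rewrite mem_filter /=.
  by case xs: (x \in s) => //=; rewrite (st _ xs).
by move=> x /F0.
Qed.

Definition free_lift (N : lmodType S) (g : X -> N) (v : free) : N :=
  \sum_(x <- supp v) coef v x *: g x.

(** Both lists are enlarged to a common one, on which the added terms vanish. The alternative
    [g x = 0] permits sums that leave out generators killed by [g]. *)
Lemma free_liftE (N : lmodType S) (g : X -> N) v s : uniq s ->
  (forall x, coef v x != 0 -> x \in s \/ g x = 0) ->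
  \sum_(x <- s) coef v x *: g x = free_lift g v.
Proof.
move=> Us sP; pose t := undup (s ++ supp v).
have tU : uniq t by apply: undup_uniq.
have st : {subset s <= t} by move=> x xs; rewrite mem_undup mem_cat xs.
have vt : {subset supp v <= t}.
  by move=> x xv; rewrite mem_undup mem_cat xv orbT.
rewrite /free_lift (sum_subset Us tU st); last first.
  move=> x xs; have [->|/sP[|->]] := eqVneq (coef v x) 0.
  - by rewrite scale0r.
  - by rewrite (negPf xs).
  by rewrite scaler0.
rewrite (sum_subset (supp_uniq v) tU vt) // => x.
by have [->|/suppP ->//] := eqVneq (coef v x) 0; rewrite scale0r.
Qed.

Lemma free_lift_linear (N : lmodType S) (g : X -> N) : linear (free_lift g).
Proof.
move=> a u v; pose s := undup (supp u ++ supp v ++ supp (a *: u + v)).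
have sU : uniq s by apply: undup_uniq.
have sE w : {subset supp w <= s} ->
    \sum_(x <- s) coef w x *: g x = free_lift g w.
  by move=> ws; apply: free_liftE => // x /suppP /ws; left.
rewrite -!sE; try by move=> x xs; rewrite mem_undup !mem_cat xs ?orbT.
rewrite scaler_sumr -big_split; apply: eq_bigr => x _ /=.
by rewrite coefP scalerDl scalerA.
Qed.

HB.instance Definition _ (N : lmodType S) (g : X -> N) :=
  GRing.isLinear.Build S free N *:%R (free_lift g) (free_lift_linear g).

Lemma free_lift_gen (N : lmodType S) (g : X -> N) x : free_lift g (gen x) = g x.
Proof.
rewrite -(@free_liftE _ _ _ [:: x]) //.
  by rewrite big_seq1 coef_gen eqxx scale1r.
move=> y; rewrite coef_gen inE.
by case: (y == x) => [_|]; [left|rewrite eqxx].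
Qed.

Lemma coef_sum (s : seq X) (a : X -> S) (u : X -> free) x :
  coef (\sum_(y <- s) a y *: u y) x = \sum_(y <- s) a y * coef (u y) x.
Proof. by elim: s => [|y s IH]; rewrite ?big_nil // !big_cons coefP IH. Qed.

Lemma free_expand v : v = \sum_(x <- supp v) coef v x *: gen x.
Proof.
apply: free_eqP => x; rewrite coef_sum.
have [v0|vx] := eqVneq (coef v x) 0.
  rewrite v0 big1 // => y _; rewrite coef_gen.
  by case: eqP => [<-|_]; rewrite ?v0 ?mul0r ?mulr0.
rewrite (bigD1_seq x) ?suppP ?supp_uniq //= big1 => [|y yx].
  by rewrite addr0 coef_gen eqxx mulr1.
by rewrite coef_gen eq_sym (negPf yx) mulr0.
Qed.

Lemma linear_freeE (N : lmodType S) (f : {linear free -> N}) v :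
  f v = \sum_(x <- supp v) coef v x *: f (gen x).
Proof.
by rewrite {1}[v]free_expand linear_sum; apply: eq_bigr => x _; rewrite linearZ.
Qed.

Lemma eq_linear_free (N : lmodType S) (f g : {linear free -> N}) v :
  (forall x, x \in supp v -> f (gen x) = g (gen x)) -> f v = g v.
Proof.
move=> fg; rewrite !linear_freeE big_seq [RHS]big_seq.
by apply: eq_bigr => x /fg ->.
Qed.

End FreeModules.

Arguments gen {S X} x.
Arguments free_lift {S X N} g v : simpl never.

Lemma free_basis (R : pzRingType) (X : choiceType) :
  @is_basis R X (free R^c X) (@gen _ X).
Proof.
move=> N g; exists (free_lift g); split=> [x|h' h'g v].
  exact: free_lift_gen.
by apply: eq_linear_free => x _; rewrite h'g /= free_lift_gen.
Qed.

(** * Products reduced modulo an ideal of sets of indices *)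

Definition subsets (T : Type) (P : set (set T)) := {A : set T | `[< P A >]}.

Section SubsetsOrder.
Variables (T : Type) (P : set (set T)).

HB.instance Definition _ := Choice.on (subsets P).

Definition subsets_le (A B : subsets P) : bool := `[< sval A `<=` sval B >].

Fact subsets_le_refl : reflexive subsets_le.
Proof. by move=> A; apply/asboolP. Qed.
Fact subsets_le_anti : antisymmetric subsets_le.
Proof.
move=> A B /andP[/asboolP AB /asboolP BA].
exact/val_inj/seteqP.
Qed.
Fact subsets_le_trans : transitive subsets_le.
Proof.
by move=> B A C /asboolP AB /asboolP BC; apply/asboolP/(subset_trans AB BC).
Qed.

HB.instance Definition _ := Order.Le_isPOrder.Build (Order.Disp tt tt)
  (subsets P) subsets_le_refl subsets_le_anti subsets_le_trans.

Lemma subsets_leP (A B : subsets P) : (A <= B)%O <-> sval A `<=` sval B.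
Proof. by split=> [/asboolP|AB]; last exact/asboolP. Qed.

Lemma subsetsP (A : subsets P) : P (sval A).
Proof. exact/asboolP/(svalP A). Qed.

Definition to_subsets A (PA : P A) : subsets P := exist _ A (asboolT PA).

End SubsetsOrder.

Record set_ideal (J : Type) := SetIdeal {
  ideal_set :> set J -> Prop;
  ideal_set0 : ideal_set set0;
  ideal_setU : forall V W, ideal_set V -> ideal_set W -> ideal_set (V `|` W) }.

Lemma ideal_directed (J : Type) (Id : set_ideal J) : directed_poset (subsets Id).
Proof.
split; first exact/inhabits/(to_subsets (ideal_set0 Id)).
move=> A B; exists (to_subsets (ideal_setU (subsetsP A) (subsetsP B))).
by split; apply/subsets_leP => j; [left|right].
Qed.

Definition incl (S : pzRingType) (V : lmodType S) (U U' : submodule V)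
    (UU' : forall x, U x -> U' x) : {linear subm U -> subm U'} :=
  corestrict (f := val) (fun x : subm U => UU' _ (submP x)).

Section ReducedProducts.
Variables (R : pzRingType) (D : rmodType R -> Prop).
Hypotheses (D_prod : closed_products D) (D_lim : closed_direct_limits D).
Variables (J : Type) (B : J -> rmodType R) (DB : forall j, D (B j)).

(** Extension by 0 identifies this submodule with the product of the factors whose index lies in
    [W]. *)
Lemma supported_in_closed (W : set J) : D (subm (supported_in B W)).
Proof.
pose p (i : {j | W j}) : {linear subm (supported_in B W) -> B (sval i)} :=
  dproj (sval i) \o val.
apply: (D_prod (p := p)) => [N g|i]; last exact: DB.
pose h0 (x : N) : dprod B := fun j =>
  if pselect (W j) is left Wj then g (exist _ j Wj) x else 0.
have h0_supp x : supported_in B W (h0 x).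
  by move=> j Wj; rewrite /h0; case: (pselect (W j)).
have h0E i x : h0 x (sval i) = g i x.
  case: i => j Wj; rewrite /h0 /=; case: (pselect (W j)) => // Wj'.
  by rewrite (Prop_irrelevance Wj' Wj).
have h_lin : linear (fun x => to_subm (h0_supp x)).
  move=> a x y; apply/val_inj/dprod_ext => j /=; rewrite !dprodE /h0.
  case: (pselect (W j)) => ? /=; first by rewrite linearP.
  by rewrite scaler0 addr0.
exists (linear_of h_lin); split=> [i x|h' h'g x]; first exact: h0E.
apply/val_inj/dprod_ext => j /=.
have [Wj|Wj] := pselect (W j); last by rewrite (submP (h' x)) // h0_supp.
by have := h'g (exist _ j Wj) x; rewrite -h0E.
Qed.

Variable Id : set_ideal J.

Definition supported_in_ideal (x : dprod B) :=
  exists2 W, Id W & supported_in B W x.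

Fact ideal_submod :
  supported_in_ideal 0 /\
  forall a x y, supported_in_ideal x -> supported_in_ideal y ->
    supported_in_ideal (a *: x + y).
Proof.
split=> [|a x y [V IV xV] [W IW yW]].
  by exists set0; [apply: ideal_set0|apply: submodule0].
exists (V `|` W); first exact: ideal_setU.
move=> j /not_orP[Vj Wj]; rewrite !dprodE.
by rewrite xV // yW // scaler0 addr0.
Qed.

Definition ideal_sum : submodule (dprod B) := submodule_of ideal_submod.

Lemma ideal_sum_sub (W : subsets Id) x :
  supported_in B (sval W) x -> ideal_sum x.
Proof. by exists (sval W) => //; apply: subsetsP. Qed.

Lemma supported_inS (V W : set J) x :
  V `<=` W -> supported_in B V x -> supported_in B W x.
Proof. by move=> VW xV j Wj; apply: xV => /VW. Qed.

Lemma supported_in_le (V W : subsets Id) : (V <= W)%O -> forall x,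
  supported_in B (sval V) x -> supported_in B (sval W) x.
Proof. by move=> /subsets_leP VW x; apply: supported_inS. Qed.

Definition ideal_sum_obj (W : subsets Id) : rmodType R :=
  subm (supported_in B (sval W)).

Definition ideal_sum_map (V W : subsets Id) (le_VW : (V <= W)%O) :
  {linear ideal_sum_obj V -> ideal_sum_obj W} := incl (supported_in_le le_VW).

Fact ideal_sum_map_id W (le_WW : (W <= W)%O) x : ideal_sum_map le_WW x = x.
Proof. exact: val_inj. Qed.

Fact ideal_sum_map_comp U V W (le_UV : (U <= V)%O) (le_VW : (V <= W)%O)
    (le_UW : (U <= W)%O) x :
  ideal_sum_map le_VW (ideal_sum_map le_UV x) = ideal_sum_map le_UW x.
Proof. exact: val_inj. Qed.

Definition ideal_sum_system : @poset_system R _ (subsets Id) :=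
  PosetSystem ideal_sum_map_id ideal_sum_map_comp.

(** The sum is the directed union of the products over the members of the ideal. A map out of it is
    evaluated at a chosen supporting set, and [hE] makes this choice immaterial by passing to a
    larger set. *)
Lemma ideal_sum_closed : D (subm ideal_sum).
Proof.
pose c (W : subsets Id) : {linear ideal_sum_system W -> subm ideal_sum} :=
  incl (@ideal_sum_sub W).
apply: (D_lim (c := c)); [exact: ideal_directed| |]; last first.
  by move=> W; apply: supported_in_closed.
split=> [V W _ _ le_VW x|N g g_cocone]; first exact: val_inj.
have suppP (x : subm ideal_sum) :
    exists W : subsets Id, supported_in B (sval W) (val x).
  by have [W IW xW] := submP x; exists (to_subsets IW).
pose s x := projT1 (cid (suppP x)).
pose sP x : supported_in B (sval (s x)) (val x) := projT2 (cid (suppP x)).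
pose h x := g (s x) Logic.I (to_subm (sP x) : ideal_sum_system (s x)).
have hE x (W : subsets Id) (xW : supported_in B (sval W) (val x)) :
    h x = g W Logic.I (to_subm xW : ideal_sum_system W).
  have [V [le_sV le_WV]] := (ideal_directed Id).2 (s x) W.
  rewrite /h -(g_cocone _ V Logic.I Logic.I le_sV).
  rewrite -(g_cocone _ V Logic.I Logic.I le_WV).
  by congr (g V _ _); apply: val_inj.
have h_lin : linear h.
  move=> a x y; have [V [le_xV le_yV]] := (ideal_directed Id).2 (s x) (s y).
  have xV := supported_in_le le_xV (sP x).
  have yV := supported_in_le le_yV (sP y).
  rewrite (hE _ _ xV) (hE _ _ yV) (hE (a *: x + y) V (submoduleP a xV yV)) -linearP.
  by congr (g V _ _); apply: val_inj.
exists (linear_of h_lin); split=> [W [] x|h' h'g x].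
  by rewrite /= (hE (c W x) W (submP x)); congr (g W _ _); apply: val_inj.
rewrite /= /h -h'g; congr (h' _); exact: val_inj.
Qed.

(** Stage [W] is the product over the complement of [W], and the transition maps forget coordinates.
    In the limit exactly the families supported in a member of the ideal die. *)
Definition reduced_product_obj (W : subsets Id) : rmodType R :=
  subm (supported_in B (~` sval W)).

Definition reduced_product_map (V W : subsets Id) (_ : (V <= W)%O) :
    {linear reduced_product_obj V -> reduced_product_obj W} :=
  @corestrict _ _ _ _ (truncate (~` sval W) \o val)
    (fun x => truncate_supported (val x)).

Fact reduced_product_map_id W (le_WW : (W <= W)%O) x :
  reduced_product_map le_WW x = x.
Proof.
apply/val_inj/dprod_ext => j /=; rewrite /truncate.
by case: pselect => //= Wj; rewrite (submP x).
Qed.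

Fact reduced_product_map_comp U V W (le_UV : (U <= V)%O) (le_VW : (V <= W)%O)
    (le_UW : (U <= W)%O) x :
  reduced_product_map le_VW (reduced_product_map le_UV x) =
  reduced_product_map le_UW x.
Proof.
apply/val_inj/dprod_ext => j /=; rewrite /truncate.
case: pselect => //= Wj; case: pselect => //= -[] Vj.
by apply: Wj; move/subsets_leP: le_VW; apply.
Qed.

Definition reduced_product_system : @poset_system R _ (subsets Id) :=
  PosetSystem reduced_product_map_id reduced_product_map_comp.

Lemma reduced_product_closed : D (quot ideal_sum).
Proof.
pose c (W : subsets Id) :
    {linear reduced_product_system W -> quot ideal_sum} :=
  coset ideal_sum \o val.
apply: (D_lim (c := c)); [exact: ideal_directed| |]; last first.
  by move=> W; apply: supported_in_closed.
split=> [V W _ _ le_VW x|N g g_cocone].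
  apply/cosetP; exists (sval W); first exact: subsetsP.
  move=> j Wj; rewrite /= !dprodE /truncate.
  by case: pselect => //= _; rewrite subrr.
(* The stage of the empty set is the whole product, and it maps onto every other stage, so a cocone
   is determined by its component at [W0]. *)
pose W0 := to_subsets (ideal_set0 Id).
have suppW0 x : supported_in B (~` sval W0) x by move=> j; case=> -[].
pose i0 : {linear dprod B -> reduced_product_system W0} :=
  corestrict (f := idfun) suppW0.
have le0 (W : subsets Id) : (W0 <= W)%O by apply/subsets_leP.
have gE x (W : subsets Id) : g W0 Logic.I (i0 x) =
    g W Logic.I (to_subm (@truncate_supported _ _ B (~` sval W) x)).
  by rewrite -(g_cocone W0 W Logic.I Logic.I (le0 W)); congr (g W _ _); apply: val_inj.
have g0 x : ideal_sum x -> g W0 Logic.I (i0 x) = 0.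
  move=> [W IW xW]; rewrite (gE x (to_subsets IW)).
  set y := to_subm _; suff -> : y = 0 by rewrite linear0.
  apply/val_inj/dprod_ext => j /=; rewrite /truncate.
  by case: pselect => //= Wj; rewrite xW.
have [h hE] := quot_lift (f := g W0 Logic.I \o i0) g0.
exists h; split=> [W [] x|h' h'g x].
  rewrite [LHS]hE /= (gE _ W); congr (g W _ _); apply/val_inj/dprod_ext => j /=.
  by rewrite /truncate; case: pselect => //= Wj; rewrite (submP x).
have [y <-] := coset_surj x; rewrite hE /= -h'g.
by congr (h' _).
Qed.

End ReducedProducts.

(** * Pure submodules and the definable closure *)

Lemma pure_mono_id (R : pzRingType) (M : rmodType R) :
  is_pure_mono (idfun : {linear M -> M}).
Proof. by split=> [x y|m n r a [y yP]] //; exists y. Qed.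

Lemma pure_mono_comp (R : pzRingType) (M N C : rmodType R)
    (f : {linear M -> N}) (g : {linear N -> C}) :
  is_pure_mono f -> is_pure_mono g -> is_pure_mono (g \o f).
Proof.
move=> [f_inj f_pure] [g_inj g_pure]; split=> [|m n r a /g_pure /f_pure //].
exact: inj_comp.
Qed.

Lemma product_equiv (R : pzRingType) (I : Type) (F : I -> rmodType R)
    (P : rmodType R) (p : forall i, {linear P -> F i}) : is_product p ->
  exists h : {linear dprod F -> P},
    cancel (dpair p) h /\ forall i x, p i (h x) = x i.
Proof.
move=> p_prod; have [h [hE _]] := p_prod _ (fun i => dproj i : {linear _ -> _}).
exists h; split=> // x.
have [k [_ kE]] := p_prod P p.
have /= -> := kE (h \o dpair p) (fun i y => hE i (dpair p y)) x.
by have /= <- := kE idfun (fun _ _ => erefl) x.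
Qed.

(** By directedness the images of the [c i] together form a submodule. The projection modulo this
    submodule and the zero map have the same composites with all [c i], so they coincide by
    uniqueness in the universal property. *)
Lemma direct_limit_surj (R : pzRingType) d (I : porderType d)
    (T : @poset_system R d I) (N : rmodType R) (c : forall i, {linear T i -> N}) :
  directed_poset I -> is_direct_limit c -> forall y, exists i x, c i x = y.
Proof.
move=> [[i0] I_dir] [c_cocone c_univ].
have im_submod : (exists i x, c i x = 0) /\
    forall a y z, (exists i x, c i x = y) -> (exists i x, c i x = z) ->
      exists i x, c i x = a *: y + z.
  split=> [|a _ _ [i [x <-]] [j [y <-]]]; first by exists i0, 0; rewrite linear0.
  have [k [le_ik le_jk]] := I_dir i j.
  exists k, (a *: sys_map T le_ik x + sys_map T le_jk y).
  by rewrite linearP !(c_cocone _ k Logic.I Logic.I).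
pose U := submodule_of im_submod.
have cU i x : coset U (c i x) = 0 by apply/coset_eq0; exists i, x.
have [|h [_ hE]] := c_univ _ (fun i _ => \0 : {linear T i -> quot U}).
  by move=> i j.
move=> y; suff /coset_eq0 : coset U y = 0 by [].
have /= -> := hE (coset U) (fun i _ x => cU i x) y.
by have /= <- := hE \0 (fun i _ x => erefl) y.
Qed.

(** Dual to the filter of tails: modulo this ideal, families are identified when they agree from
    some index on. *)
Definition tail_ideal_set d (I : porderType d) (W : set I) :=
  exists i : I, forall j, (i <= j)%O -> ~ W j.

Fact tail_ideal_subproof d (I : porderType d) (I_dir : directed_poset I) :
  tail_ideal_set (set0 : set I) /\
  forall V W : set I, tail_ideal_set V -> tail_ideal_set W ->
    tail_ideal_set (V `|` W).
Proof.
split; first by have [[i] _] := I_dir; exists i => j _ [].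
move=> V W [i iV] [j jW]; have [k [le_ik le_jk]] := I_dir.2 i j.
exists k => l le_kl [|]; first by apply: iV; apply: le_trans le_kl.
by apply: jW; apply: le_trans le_kl.
Qed.

Definition tail_ideal d (I : porderType d) (I_dir : directed_poset I) :
  set_ideal I :=
  SetIdeal (tail_ideal_subproof I_dir).1 (tail_ideal_subproof I_dir).2.

Lemma dependent_choice_fun (I : Type) (T : I -> Type)
    (P : forall i, T i -> Prop) :
  (forall i, exists x, P i x) -> exists f : forall i, T i, forall i, P i (f i).
Proof.
by move=> ex; exists (fun i => projT1 (cid (ex i))) => i; apply: projT2 (cid (ex i)).
Qed.

Section PureClosure.
Variables (R : pzRingType) (B : rmodType R -> Prop).
Hypotheses (B_lim : closed_direct_limits B) (B_prod : closed_products B).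

(** This class is shown to be definable, so it contains the definable closure, whose members thereby
    acquire a concrete pure embedding into a module of [B]. *)
Definition pure_closure (N : rmodType R) : Prop :=
  exists (C : rmodType R) (f : {linear N -> C}), B C /\ is_pure_mono f.

Lemma pure_closure_sub N : B N -> pure_closure N.
Proof. by move=> BN; exists N, idfun; split=> //; apply: pure_mono_id. Qed.

Lemma pure_closure_pure : closed_pure_submodules pure_closure.
Proof.
move=> M N f f_pure [C [g [BC g_pure]]].
by exists C, (g \o f); split=> //; apply: pure_mono_comp.
Qed.

Lemma dprod_closed (J : Type) (C : J -> rmodType R) :
  (forall j, B (C j)) -> B (dprod C).
Proof.
move=> BC; apply: (B_prod (p := fun j => dproj j : {linear dprod C -> C j})) => //.
move=> N g; exists (dpair g); split=> [//|h' h'g x].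
by apply: dprod_ext => j; exact: (h'g j x).
Qed.

(** A product of pure embeddings is pure because a finite system over a product is solved one
    coordinate at a time. *)
Lemma pure_closure_products : closed_products pure_closure.
Proof.
move=> I F P p p_prod /choice[C /dependent_choice_fun[f fP]].
have [h [pK hE]] := product_equiv p_prod.
exists (dprod C), (dpair (fun i => f i \o p i)); split.
  by apply: dprod_closed => i; case: (fP i).
split=> [x y fxy|m n r a [y yP]].
  rewrite -(pK x) -(pK y); congr (h _); apply: dprod_ext => i.
  by case: (fP i) => _ [f_inj _]; apply: f_inj; apply: (congr1 (fun z => z i)) fxy.
have solve i : exists x : 'I_m -> F i, forall j, \sum_k r k j *: x k = p i (a j).
  case: (fP i) => _ [_ f_pure]; apply: f_pure.
  exists (fun k => y k i) => j.
  have /(congr1 (dproj i)) := yP j; rewrite linear_sum => yE.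
  by apply: etrans yE; apply: eq_bigr => k _.
have [x xP] := dependent_choice_fun solve.
exists (fun k => h (fun i => x i k)) => j.
rewrite -[RHS]pK -[LHS]pK; congr (h _); apply: dprod_ext => i.
rewrite /dpair -xP linear_sum; apply: eq_bigr => k _.
by rewrite linearZ /= hE.
Qed.

(** The chosen embeddings [f i] need not commute with the system. An element of [T i] is sent to the
    family of its images under [T i -> T j -> C j], modulo families vanishing on a tail; this
    reduced product lies in [B]. An equality there holds from some index on, so a finite system
    solvable there is solvable in some [C i], hence in [T i] by purity of [f i]. *)
Lemma pure_closure_direct_limits : closed_direct_limits pure_closure.
Proof.
move=> d I T N c I_dir c_lim /choice[C /dependent_choice_fun[f fP]].
have [c_cocone c_univ] := c_lim.
have c_surj := direct_limit_surj I_dir c_lim.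
pose U := ideal_sum C (tail_ideal I_dir).
(* The default 0 at indices not above [i] disappears modulo the tail ideal. *)
pose t i j x : C j :=
  if pselect (i <= j)%O is left le_ij then f j (sys_map T le_ij x) else 0.
have tE i j x (le_ij : (i <= j)%O) : t i j x = f j (sys_map T le_ij x).
  by rewrite /t; case: pselect => // le_ij'; rewrite (bool_irrelevance le_ij le_ij').
have t_lin i : linear (fun x => (fun j => t i j x) : dprod C).
  move=> a x y; apply: dprod_ext => j; rewrite !dprodE /t.
  by case: pselect => [le_ij|] /=; rewrite ?linearP ?scaler0 ?addr0.
pose g i : {linear T i -> quot U} := coset U \o linear_of (t_lin i).
have UP (x y : dprod C) : coset U x = coset U y <->
    exists i : I, forall j, (i <= j)%O -> x j = y j.
  split=> [/cosetP[W [i iW] xyW]|[i xy]].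
    exists i => j le_ij; apply/eqP; rewrite -subr_eq0; apply/eqP.
    exact/xyW/iW.
  apply/cosetP; exists (fun j => ~ (i <= j)%O); first by exists i => j le_ij; apply.
  by move=> j /contrapT le_ij; rewrite !dprodE xy // subrr.
have [|h [hE _]] := c_univ _ (fun i _ => g i).
  move=> i j _ _ le_ij x; apply/UP; exists j => k le_jk /=.
  have le_ik := le_trans le_ij le_jk.
  by rewrite (tE _ _ _ le_jk) (tE _ _ _ le_ik) (sys_map_comp _ _ le_ik).
have f_inj i : injective (f i) by case: (fP i) => _ [].
exists (quot U), h; split.
  by apply: reduced_product_closed => // j; case: (fP j).
split.
  move=> x y /eqP; rewrite -subr_eq0 -linearB => /eqP hxy.
  apply/eqP; rewrite -subr_eq0; apply/eqP.
  have [i [z zE]] := c_surj (x - y); move: hxy; rewrite -zE (hE i Logic.I).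
  rewrite -(linear0 (coset U)) => /UP[j jP].
  have [k [le_ik le_jk]] := I_dir.2 i j.
  have := jP k le_jk; rewrite /= (tE _ _ _ le_ik) dprodE -(linear0 (f k)).
  move=> /f_inj zk0; rewrite -(c_cocone i k Logic.I Logic.I le_ik).
  by rewrite zk0 linear0.
move=> m n r a [y yP].
have upper (l : nat) (b : 'I_l -> I) : exists i, forall j, (b j <= i)%O.
  elim: l b => [|l IH] b; first by have [[i] _] := I_dir; exists i => -[].
  have [i iP] := IH (b \o lift ord0); have [k [le_ik le_0k]] := I_dir.2 i (b ord0).
  exists k => j; case: (unliftP ord0 j) => [j'|] -> //.
  exact: le_trans (iP j') le_ik.
have [i0 a_i0] : exists i (b : 'I_n -> T i), forall j, c i (b j) = a j.
  have [s /dependent_choice_fun[u uP]] := choice (fun j => c_surj (a j)).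
  have [i iP] := upper _ s; exists i, (fun j => sys_map T (iP j) (u j)) => j.
  by rewrite (c_cocone _ i Logic.I Logic.I).
have [b bE] := a_i0.
have [z zE] := choice (fun k => coset_surj (y k)).
have eventually j : exists i : I, forall l, (i <= l)%O ->
    (\sum_k r k j *: z k : dprod C) l = t i0 l (b j).
  apply/UP; have := yP j; rewrite -bE (hE i0 Logic.I) => yE.
  by apply: etrans yE; rewrite linear_sum; apply: eq_bigr => k _; rewrite linearZ /= zE.
have [s sP] := choice eventually.
have [i1 i1P] := upper _ s.
have [i [le_i0 le_i1]] := I_dir.2 i0 i1.
have [|x xP] := (fP i).2.2 m n r (fun j => sys_map T le_i0 (b j)).
  exists (fun k => z k i) => j.
  rewrite -tE -(sP j); last exact: le_trans (i1P j) le_i1.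
  by rewrite -[RHS]/(dproj i _) linear_sum; apply: eq_bigr => k _.
exists (fun k => c i (x k)) => j.
rewrite -bE -(c_cocone i0 i Logic.I Logic.I le_i0) -xP linear_sum.
by apply: eq_bigr => k _; rewrite linearZ.
Qed.

Lemma definable_closure_pure N : definable_closure B N -> pure_closure N.
Proof.
move=> BN; apply: BN => [|M]; last exact: pure_closure_sub.
split; [exact: pure_closure_products|exact: pure_closure_direct_limits|].
exact: pure_closure_pure.
Qed.

End PureClosure.

Lemma definable_closure_products (R : pzRingType) (B : rmodType R -> Prop) :
  closed_products (definable_closure B).
Proof.
move=> I F P p p_prod BF D D_def BD; have [D_prod _ _] := D_def.
by apply: D_prod p_prod _ => i; apply: BF.
Qed.

Lemma definable_closure_direct_limits (R : pzRingType)
    (B : rmodType R -> Prop) : closed_direct_limits (definable_closure B).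
Proof.
move=> d I T N c I_dir c_lim BT D D_def BD; have [_ D_lim _] := D_def.
by apply: D_lim I_dir c_lim _ => i; apply: BT.
Qed.

(** * Extensions and free presentations *)

(** A homomorphism from the submodule [U] is encoded as a function on all of [V] with arbitrary
    values outside [U]; this avoids maps out of subtypes. *)
Definition linear_on (S : pzRingType) (V W : lmodType S) (U : submodule V)
    (f : V -> W) : Prop :=
  forall a x y, U x -> U y -> f (a *: x + y) = a *: f x + f y.

Definition extends_from (S : pzRingType) (V : lmodType S) (U : submodule V)
    (W : lmodType S) : Prop :=
  forall f : V -> W, linear_on U f ->
    exists h : {linear V -> W}, forall x, U x -> h x = f x.

Section LinearOn.
Variables (S : pzRingType) (V W : lmodType S) (U : submodule V).
Implicit Types f : V -> W.

Lemma linear_on0 f : linear_on U f -> f 0 = 0.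
Proof.
move=> f_lin; have := f_lin (-1) 0 0 (submodule0 U) (submodule0 U).
by rewrite scaler0 addr0 scaleN1r addNr.
Qed.

Lemma linear_onD f x y : linear_on U f -> U x -> U y -> f (x + y) = f x + f y.
Proof. by move=> f_lin Ux Uy; have := f_lin 1 x y Ux Uy; rewrite !scale1r. Qed.

Lemma linear_on_linear (f : {linear V -> W}) : linear_on U f.
Proof. by move=> a x y _ _; rewrite linearP. Qed.

Lemma linear_on_sub f (h : {linear V -> W}) :
  linear_on U f -> linear_on U (fun x => f x - h x).
Proof.
move=> f_lin a x y Ux Uy; rewrite f_lin // linearP scalerBr opprD.
by rewrite addrACA.
Qed.

Lemma linear_on_span (X : set V) (f g : V -> W) :
  (forall x, X x -> U x) -> linear_on U f -> linear_on U g ->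
  (forall x, X x -> f x = g x) -> forall x, span X x -> f x = g x.
Proof.
move=> XU f_lin g_lin fg.
have eq_submod : (U 0 /\ f 0 = g 0) /\ forall a x y, U x /\ f x = g x ->
    U y /\ f y = g y -> U (a *: x + y) /\ f (a *: x + y) = g (a *: x + y).
  split=> [|a x y [Ux fx] [Uy fy]].
    by split; [apply: submodule0|rewrite !linear_on0].
  by split; [apply: submoduleP|rewrite f_lin // g_lin // fx fy].
move=> x /(_ (submodule_of eq_submod)) [] // y Xy.
by split; [apply: XU|apply: fg].
Qed.

End LinearOn.

Section ExtFreePresentation.
Variables (R : pzRingType).

(** In the pushout, [(0, v)] and [(f v, 0)] coincide for [v] in the kernel of [p]. An equivalence
    with the split extension, read on the elements [(0, v)] in the coordinate [C], is therefore the
    required extension of [f]. *)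
Lemma ext1_extends (F M C : rmodType R) (p : {linear F -> M}) :
  is_surjective p -> Ext1_vanishes M C -> extends_from (ker_submodule p) C.
Proof.
move=> p_surj ext0 f f_lin; pose CF : rmodType R := (C * F)%type.
(* The pushout of [ker p -> F] along [f]. *)
have graph_submod : (p (0 : CF).2 = 0 /\ (0 : CF).1 = - f (0 : CF).2) /\
    forall a (x y : CF), p x.2 = 0 /\ x.1 = - f x.2 ->
      p y.2 = 0 /\ y.1 = - f y.2 ->
      p (a *: x + y).2 = 0 /\ (a *: x + y).1 = - f (a *: x + y).2.
  split; first by rewrite /= linear0 (linear_on0 f_lin) oppr0.
  move=> a [x1 x2] [y1 y2] /= [px ->] [py ->].
  by rewrite linearP px py scaler0 addr0 f_lin // opprD scalerN.
pose U := submodule_of graph_submod; pose E : rmodType R := quot U.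
have in_lin : linear (fun c : C => coset U ((c, 0) : CF)).
  by move=> a x y; rewrite -linearP; congr (coset U (_, _)); rewrite /= scaler0 addr0.
have p2 x : U x -> (p \o snd : {linear CF -> M}) x = 0 by case.
have [out outE] := quot_lift p2.
pose in_ : {linear C -> E} := linear_of in_lin.
have in_inj : injective in_.
  move=> x y /= /cosetP [_ /=]; rewrite subrr (linear_on0 f_lin) oppr0.
  by move/eqP; rewrite subr_eq0 => /eqP.
have out_surj : is_surjective out.
  move=> y; have [x <-] := p_surj y.
  by exists (coset U ((0, x) : CF)); rewrite outE.
have in_ker v : p v = 0 -> coset U ((0, v) : CF) = in_ (f v).
  move=> pv; apply/cosetP; split=> /=; first by rewrite subr0.
  by rewrite subr0 add0r.
have exact_io : is_exact in_ out.
  move=> y; have [[c v] <-] := coset_surj y; rewrite outE; split=> [pv|[x]].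
    exists (c + f v); rewrite (linearD in_) -in_ker //= -linearD.
    by congr (coset U (_, _)); rewrite /= ?addr0 ?add0r.
  by move=> /cosetP [/=]; rewrite sub0r linearN => /eqP; rewrite oppr_eq0 => /eqP.
have [phi [phi_in _]] := ext0 (Extension in_inj out_surj exact_io).
have h_lin : linear (fun v : F => (phi (coset U ((0, v) : CF))).1 : C).
  move=> a x y; rewrite -[RHS]/((a *: phi (coset U ((0, x) : CF)) +
    phi (coset U ((0, y) : CF))).1) -!linearP.
  by congr (phi (coset U (_, _))).1; rewrite /= scaler0 addr0.
exists (linear_of h_lin) => v /in_ker /= ->.
by have /= -> := phi_in (f v).
Qed.

(** Freeness lifts [p] to a map [q] into [E], which sends the kernel of [p] into the image of [C].
    If [h] extends this restriction to the free module, then [q - i h] kills the kernel and factors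
    through a section of [o], which splits the extension. *)
Lemma extends_ext1 (X : choiceType) (M C : rmodType R)
    (p : {linear free R^c X -> M}) : is_surjective p ->
  extends_from (ker_submodule p) C -> Ext1_vanishes M C.
Proof.
move=> p_surj p_ext [E i o i_inj o_surj io_exact].
have [g gP] := choice o_surj.
pose q : {linear free R^c X -> E} := free_lift (fun x => g (p (gen x))).
have oq v : o (q v) = p v.
  apply: (eq_linear_free (f := o \o q) (g := p)) => x _ /=.
  by rewrite free_lift_gen gP.
have i_inv y : exists c, o y = 0 -> i c = y.
  have [/io_exact[c <-]|oy] := pselect (o y = 0); first by exists c.
  by exists 0.
have [r rP] := choice i_inv.
have rq v : p v = 0 -> i (r (q v)) = q v by move=> pv; apply: rP; rewrite oq.
have r_lin : linear_on (ker_submodule p) (fun v => r (q v)).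
  move=> a x y px py; apply: i_inj; rewrite (linearP i) (rq x) // (rq y) //.
  by rewrite (rq _ (submoduleP a px py)) linearP.
have [h hP] := p_ext _ r_lin.
pose d : {linear free R^c X -> E} := q \- (i \o h).
have d_ker v : p v = 0 -> d v = 0.
  by move=> pv; rewrite /d /= hP // rq // subrr.
have od v : o (d v) = p v.
  rewrite /d /= linearB oq; have -> : o (i (h v)) = 0 by apply/io_exact; exists (h v).
  by rewrite subr0.
have [s sp] := factor_surj p_surj d_ker.
have os y : o (s y) = y by have [x <-] := p_surj y; rewrite sp od.
have irs y : i (r (y - s (o y))) = y - s (o y).
  by apply: rP; rewrite linearB os subrr.
have phi_lin : linear (fun y => (r (y - s (o y)), o y) : (C * M)%type).
  move=> a x y; congr (_, _) => /=; last by rewrite linearP.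
  apply: i_inj; rewrite (linearP i) !irs (linearP o) (linearP s) (scalerBr a x) opprD.
  by rewrite addrACA.
exists (linear_of phi_lin); split=> //= x.
have ox : o (i x) = 0 by apply/io_exact; exists x.
congr (_, _) => //; apply: i_inj.
by rewrite irs ox linear0 subr0.
Qed.

End ExtFreePresentation.

(** * Closed sets of generators and relations *)

Section ClosedSets.
Variables (R : pzRingType) (X : choiceType) (K : submodule (free R^c X)).
Local Notation F := (free R^c X).
Local Notation T := (X + F)%type.

(* A set [A : set T] stands for the module presented by the generators [x] with
   [inl x] in [A] and the relations [s] in [K] with [inr s] in [A]. *)
Definition gens (A : set T) (x : X) : Prop := A (inl x).
Definition rels (A : set T) (s : F) : Prop := K s /\ A (inr s).

Definition has_gens (A : set T) : Prop :=
  forall s x, rels A s -> x \in supp s -> gens A x.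

Lemma rels_vanish (N : rmodType R) (g : {linear F -> N}) (A : set T) s :
  has_gens A -> (forall x, gens A x -> g (gen x) = 0) -> rels A s -> g s = 0.
Proof.
move=> A_gens gA As; rewrite (@eq_linear_free _ _ _ g \0) // => x xs.
by rewrite gA //; apply: A_gens xs.
Qed.

Definition finitary_ideal_set J (P : J -> set T) (W : set J) : Prop :=
  exists l : seq T, forall j, (forall t, t \in l -> P j t) -> ~ W j.

Fact finitary_ideal_subproof J (P : J -> set T) :
  finitary_ideal_set P set0 /\
  forall V W : set J, finitary_ideal_set P V -> finitary_ideal_set P W ->
    finitary_ideal_set P (V `|` W).
Proof.
split; first by exists [::] => j _ [].
move=> V W [k kV] [l lW]; exists (k ++ l) => j klj [].
  by apply: kV => t tk; apply: klj; rewrite mem_cat tk.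
by apply: lW => t tl; apply: klj; rewrite mem_cat tl orbT.
Qed.

(* Dual to the filter generated by the sets of all [j] such that [P j] contains a
   given finite set. *)
Definition finitary_ideal J (P : J -> set T) : set_ideal J :=
  SetIdeal (finitary_ideal_subproof P).1 (finitary_ideal_subproof P).2.

Section FinitarySums.
Variables (J : Type) (P : J -> set T) (C : J -> rmodType R).
Local Notation sum := (ideal_sum C (finitary_ideal P)).

Lemma finitary_sumP (x : dprod C) : sum x <->
  exists l : seq T, forall j, (forall t, t \in l -> P j t) -> x j = 0.
Proof.
split=> [[W [l lW] xW]|[l lx]]; first by exists l => j /lW; apply: xW.
exists (fun j => ~ forall t, t \in l -> P j t); first by exists l => j lj; apply.
by move=> j /contrapT /lx.
Qed.

Lemma finitary_sum_seq (Y : eqType) (v : Y -> dprod C) (s : seq Y) :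
  (forall y, y \in s -> sum (v y)) ->
  exists l : seq T, forall y j, y \in s -> (forall t, t \in l -> P j t) ->
    v y j = 0.
Proof.
elim: s => [|y s IH] sv; first by exists [::].
have [|l lv] := IH; first by move=> z zs; apply: sv; rewrite inE zs orbT.
have /finitary_sumP[k kv] : sum (v y) by apply: sv; rewrite inE eqxx.
exists (k ++ l) => z j; rewrite inE => zys klj.
have kj t : t \in k -> P j t by move=> tk; apply: klj; rewrite mem_cat tk.
have lj t : t \in l -> P j t by move=> tl; apply: klj; rewrite mem_cat tl orbT.
by case/orP: zys => [/eqP->|zs]; [apply: kv|apply: lv].
Qed.

Variable f : forall j, F -> C j.
Hypotheses (f_lin : forall j, linear_on K (f j))
  (f_sum : forall s, K s -> sum (fun j => f j s)).

Lemma extend_to_sum (D : rmodType R -> Prop) :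
  exists g : F -> subm sum, linear_on K g /\
    forall s j, K s -> val (g s) j = f j s.
Proof.
have ex s : exists y : subm sum, K s -> val y = (fun j => f j s).
  have [/f_sum fs|Ks] := pselect (K s); first by exists (to_subm fs).
  by exists 0.
have [g gP] := choice ex; exists g; split=> [a x y Kx Ky|s j Ks].
  apply/val_inj; rewrite /= (gP _ (submoduleP a Kx Ky)) (gP _ Kx) (gP _ Ky).
  by apply: dprod_ext => j; rewrite !dprodE f_lin.
by rewrite gP.
Qed.

End FinitarySums.

(** For [A] containing the generators of its relations, this yields injectivity of the map from the
    module presented by [A] to [F / K]: a map killing the relations in [A] is corrected so as to
    kill [K], without changing it on the generators in [A]. *)
Definition relative_extension (A : set T) (C : rmodType R) : Prop :=
  forall f : F -> C, linear_on K f -> (forall s, rels A s -> f s = 0) ->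
    exists h : {linear F -> C}, (forall s, K s -> h s = f s) /\
      forall x, gens A x -> h (gen x) = 0.

Variables (B : rmodType R -> Prop).
Hypotheses (B_lim : closed_direct_limits B) (B_prod : closed_products B).
Hypothesis K_ext : forall C, B C -> extends_from K C.

Lemma closed_relative_extension : exists phi : X -> seq T, forall A : set T,
  (forall x t, gens A x -> t \in phi x -> A t) ->
  forall C, B C -> relative_extension A C.
Proof.
pose J := {A : set T | ~ forall C, B C -> relative_extension A C}.
have bad (j : J) : exists (C : rmodType R) (f : F -> C), [/\ B C, linear_on K f,
    forall s, rels (sval j) s -> f s = 0 &
    ~ exists h : {linear F -> C}, (forall s, K s -> h s = f s) /\
      forall x, gens (sval j) x -> h (gen x) = 0].
  case: j => A /= /existsNP[C /not_implyP[BC /existsNP[f]]].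
  by move=> /not_implyP[f_lin /not_implyP[fA nh]]; exists C, f.
have [C /dependent_choice_fun[f fP]] := choice bad.
(* The one-element list suffices: [f j] kills [s] as soon as the bad set [j] contains [s]. *)
have f_sum s : K s -> ideal_sum C (finitary_ideal sval) (fun j => f j s).
  move=> Ks; apply/finitary_sumP; exists [:: inr s] => j js.
  by case: (fP j) => _ _ -> //; split=> //; apply: js; rewrite inE.
have f_lin j : linear_on K (f j) by case: (fP j).
have [g [g_lin gE]] := extend_to_sum f_lin f_sum B.
have [|h hE] := K_ext _ g_lin.
  by apply: ideal_sum_closed => // j; case: (fP j).
have fin x : exists l : seq T, forall j, (forall t, t \in l -> sval j t) ->
    val (h (gen x)) j = 0 by exact/finitary_sumP/submP.
have [phi phiP] := choice fin; exists phi => A A_closed.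
(* A closed set that is bad is itself an index, and the coordinate of [h] at this index is the
   extension it is supposed to lack. *)
apply: contrapT => nA; pose j : J := exist _ A nA.
case: (fP j) => _ _ _; apply; exists (dproj j \o val \o h); split=> [s Ks|x Ax] /=.
  by rewrite hE // /dproj gE.
by apply: phiP => t; apply: A_closed.
Qed.

(** Here [f j] is linear only on the span of the relations in the set [j], so the joint family is
    linear on [K] only modulo families supported in the ideal. This is why the target is the
    quotient of the product and not the sum. *)
Lemma closed_span_extension : exists phi : F -> seq T, forall A : set T,
  (forall s t, rels A s -> t \in phi s -> A t) ->
  forall C, B C -> extends_from (span (rels A)) C.
Proof.
pose J := {A : set T | ~ forall C, B C -> extends_from (span (rels A)) C}.
have bad (j : J) : exists (C : rmodType R) (f : F -> C), [/\ B C,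
    linear_on (span (rels (sval j))) f &
    ~ exists h : {linear F -> C}, forall s, span (rels (sval j)) s -> h s = f s].
  case: j => A /= /existsNP[C /not_implyP[BC /existsNP[f]]].
  by move=> /not_implyP[f_lin nh]; exists C, f.
have [C /dependent_choice_fun[f fP]] := choice bad.
pose U := ideal_sum C (finitary_ideal sval).
have g_lin : linear_on K (fun s => coset U (fun j => f j s)).
  move=> a x y Kx Ky; rewrite -linearP; apply/cosetP/finitary_sumP.
  exists [:: inr x; inr y] => j jxy; rewrite !dprodE.
  case: (fP j) => _ f_lin _; rewrite f_lin ?subrr //; apply: span_sub.
    by split=> //; apply: jxy; rewrite inE eqxx.
  by split=> //; apply: jxy; rewrite !inE eqxx orbT.
have [|h hE] := K_ext _ g_lin.
  by apply: reduced_product_closed => // j; case: (fP j).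
(* Since [F] is free, [h] lifts through the quotient. The lift agrees with [f] at a given relation
   only at the indices containing some finite set, and this set becomes [phi s]. *)
pose k : {linear F -> dprod C} := free_lift (fun x => val (h (gen x))).
have kE v : coset U (k v) = h v.
  apply: (eq_linear_free (f := coset U \o k)) => x _ /=.
  by rewrite free_lift_gen coset_val.
have fin s : exists l : seq T, K s ->
    forall j, (forall t, t \in l -> sval j t) -> k s j = f j s.
  have [Ks|] := pselect (K s); last by exists [::].
  have /cosetP/finitary_sumP[l lP] : coset U (k s) = coset U (fun j => f j s).
    by rewrite kE hE.
  by exists l => _ j /lP /eqP; rewrite !dprodE subr_eq0 => /eqP.
have [phi phiP] := choice fin; exists phi => A A_closed.
apply: contrapT => nA; pose j : J := exist _ A nA.
case: (fP j) => _ f_lin; apply; exists (dproj j \o k) => s As.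
apply: (linear_on_span (U := span (rels A))) As => //.
- exact: span_sub.
- exact: linear_on_linear.
move=> {}s As; apply: phiP => [|t]; first by case: As.
exact: A_closed As.
Qed.

(* The Mittag-Leffler condition, uniformly in [C]: the set of restrictions to the
   generators in [a] of maps killing the relations in [b] does not shrink past [b]. *)
Definition stabilizes (A : set T) (a b : seq T) : Prop :=
  forall C, B C -> forall g : {linear F -> C},
    (forall x, gens A x -> g (gen x) = 0) ->
    (forall s, K s -> inr s \in b -> g s = 0) ->
    exists g' : {linear F -> C}, [/\ forall s, K s -> g' s = 0,
      forall x, gens A x -> g' (gen x) = 0 &
      forall x, inl x \in a -> g' (gen x) = g (gen x)].

Lemma stabilizesS (A : set T) (a b c : seq T) :
  {subset b <= c} -> stabilizes A a b -> stabilizes A a c.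
Proof. by move=> bc st C BC g gA gc; apply: st => // s Ks /bc; apply: gc. Qed.

(** Otherwise every finite list [b] has a counterexample [g b]. A relation is killed by [g b] once
    it lies in [b], so the family restricts to one map from [K] to the finitary sum, and this
    extends to some [h] killing the generators in [A]. At the generators in [a], [h] vanishes at
    every index containing some fixed list. *)
Lemma stabilizes_ex (A : set T) : has_gens A ->
  (forall C, B C -> relative_extension A C) ->
  forall a, exists b, stabilizes A a b.
Proof.
move=> A_gens A_ext a; apply: contrapT => /forallNP nst.
have bad (b : seq T) : exists (C : rmodType R) (g : {linear F -> C}), [/\ B C,
    forall x, gens A x -> g (gen x) = 0,
    forall s, K s -> inr s \in b -> g s = 0 &
    ~ exists g' : {linear F -> C}, [/\ forall s, K s -> g' s = 0,
      forall x, gens A x -> g' (gen x) = 0 &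
      forall x, inl x \in a -> g' (gen x) = g (gen x)]].
  have /existsNP[C /not_implyP[BC /existsNP[g]]] := nst b.
  by move=> /not_implyP[gA /not_implyP[gb ng']]; exists C, g.
have [C /dependent_choice_fun[g gP]] := choice bad.
pose P (b : seq T) : set T := fun t => t \in b.
have g_sum s : K s -> ideal_sum C (finitary_ideal P) (fun b => g b s).
  move=> Ks; apply/finitary_sumP; exists [:: inr s] => b bs.
  by case: (gP b) => _ _ -> //; apply: bs; rewrite inE.
have g_lin b : linear_on K (g b) by exact: linear_on_linear.
have [f [f_lin fE]] := extend_to_sum g_lin g_sum B.
have f_A s : rels A s -> f s = 0.
  move=> As; apply/val_inj/dprod_ext => b; rewrite fE; last by case: As.
  by case: (gP b) => _ gA _ _; apply: rels_vanish As.
have [|h [hK hA]] := A_ext _ _ f f_lin f_A.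
  by apply: ideal_sum_closed => // b; case: (gP b).
(* Relations listed in [a] impose nothing and get the dummy value 0. *)
pose v (t : T) : dprod C := if t is inl x then val (h (gen x)) else 0.
have [|b bP] := @finitary_sum_seq _ P C _ v a.
  by move=> [x|s] _; [apply: submP|apply: submodule0].
(* The fixed list [b] contains itself, so at the index [b] the correction by [h] does not change
   [g b] on [a], contradicting the choice of [g b]. *)
case: (gP b) => _ gA _; apply; exists (g b \- (dproj b \o val \o h)).
split=> [s Ks|x Ax|x ax] /=.
- by rewrite hK // /dproj fE // subrr.
- by rewrite hA // gA // /dproj sub0r oppr0.
by have /= := bP (inl x) b ax (fun t tb => tb); rewrite /dproj => ->; rewrite subr0.
Qed.

End ClosedSets.

(** * Extending maps into pure submodules *)

(** The prescribed values form a finite linear system whose unknowns are the images of the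
    generators outside [Z] occurring in [eqs]. The map [h] solves it in [C], so purity solves it in
    [N]. *)
Lemma pure_free_extension (R : pzRingType) (X : choiceType) (N C : rmodType R)
    (i : {linear N -> C}) (h : {linear free R^c X -> C})
    (eqs : seq (free R^c X * N)) (Z : X -> Prop) : is_pure_mono i ->
  (forall e, e \in eqs -> h e.1 = i e.2) -> (forall x, Z x -> h (gen x) = 0) ->
  exists h' : {linear free R^c X -> N},
    (forall e, e \in eqs -> h' e.1 = e.2) /\ (forall x, Z x -> h' (gen x) = 0).
Proof.
move=> [_ i_pure] h_eqs hZ.
pose V := undup [seq x <- flatten [seq supp e.1 | e <- eqs] | ~~ `[< Z x >]].
have V_uniq : uniq V by apply: undup_uniq.
have V_supp e x : e \in eqs -> coef e.1 x != 0 -> x \in V \/ Z x.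
  move=> e_eqs /suppP ex; have [Zx|Zx] := pselect (Z x); [by right|left].
  rewrite mem_undup mem_filter; apply/andP; split; first exact/asboolPn.
  by apply/flatten_mapP; exists e.
have sumV (N' : rmodType R) (g : X -> N') e : e \in eqs ->
    (forall x, Z x -> g x = 0) ->
    \sum_(k < size V) coef e.1 (tnth (in_tuple V) k) *: g (tnth (in_tuple V) k) =
    free_lift g e.1.
  move=> e_eqs gZ; have V_cover x : coef e.1 x != 0 -> x \in V \/ g x = 0.
    by move=> /(V_supp _ _ e_eqs)[|/gZ]; [left|right].
  by rewrite -(free_liftE V_uniq V_cover) [RHS]big_tnth.
pose r : 'M[R^c]_(size V, size eqs) :=
  \matrix_(k, j) coef (tnth (in_tuple eqs) j).1 (tnth (in_tuple V) k).
have [|z zP] := i_pure _ _ r (fun j => (tnth (in_tuple eqs) j).2).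
  exists (fun k => h (gen (tnth (in_tuple V) k))) => j.
  have j_eqs : tnth (in_tuple eqs) j \in eqs by apply: mem_tnth.
  rewrite -h_eqs // linear_freeE -[RHS](sumV _ (fun x => h (gen x))) //.
  by apply: eq_bigr => k _; rewrite mxE.
(* As [V] has no repetitions, at most one term occurs; the sum is empty, hence 0, at generators
   outside [V]. *)
pose g x := \sum_(k < size V | tnth (in_tuple V) k == x) z k.
have gZ x : Z x -> g x = 0.
  move=> Zx; apply: big1 => k /eqP kx.
  have : x \in V by rewrite -kx; apply: mem_tnth.
  by rewrite mem_undup mem_filter => /andP[/asboolPn].
exists (free_lift g); split=> [e e_eqs|x Zx] /=; last by rewrite free_lift_gen gZ.
have [j ->] : exists j, e = tnth (in_tuple eqs) j by apply/tnthP.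
rewrite -sumV ?mem_tnth // -zP; apply: eq_bigr => k _; rewrite mxE.
congr (_ *: _); rewrite /g (big_pred1 k) // => l /=.
by apply/eqP/eqP => [/(tuple_uniqP (in_tuple V) V_uniq)|->].
Qed.

Section PureExtension.
Variables (R : pzRingType) (X : choiceType) (K : submodule (free R^c X)).
Local Notation F := (free R^c X).
Local Notation T := (X + F)%type.
Variables (B : rmodType R -> Prop).
Hypotheses (B_lim : closed_direct_limits B) (B_prod : closed_products B).
Variable phi : T -> seq T.

Definition phi_closed (A : set T) : Prop :=
  forall t u, A t -> u \in phi t -> A u.

Definition generation (t : T) (n : nat) : seq T :=
  iter n (fun l => flatten (map phi l)) [:: t].

(** A countable union of finite lists. Countability keeps orbits below every uncountable regular
    cardinal and allows maps on them to be built in countably many finite steps. *)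
Definition orbit (t : T) : set T := fun u => exists n, u \in generation t n.

Lemma generationS t n u v :
  u \in generation t n -> v \in phi u -> v \in generation t n.+1.
Proof. by move=> un vu; apply/flatten_mapP; exists u. Qed.

Lemma orbit_closed t : phi_closed (orbit t).
Proof. by move=> u v [n un] vu; exists n.+1; apply: generationS vu. Qed.

Lemma orbit_id t : orbit t t.
Proof. by exists 0%N; rewrite inE. Qed.

Lemma phi_closedU A A' :
  phi_closed A -> phi_closed A' -> phi_closed (A `|` A').
Proof.
by move=> Ac A'c t u [tA|tA] ut; [left; apply: Ac ut|right; apply: A'c ut].
Qed.

Hypothesis phi_supp : forall s x, x \in supp s -> inl x \in phi (inr s).
Hypothesis phi_ext : forall A : set T, phi_closed A ->
  forall C, B C -> relative_extension K A C.

Lemma phi_closed_gens A : phi_closed A -> has_gens K A.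
Proof. by move=> Ac s x [_ As] xs; apply: (Ac (inr s)) => //; apply: phi_supp. Qed.

Variables (N C : rmodType R) (i : {linear N -> C}).
Hypotheses (BC : B C) (i_pure : is_pure_mono i).

(** Let [h1] extend [i f] and kill the generators in [A]. The difference [i e - h1] kills the
    relations in [b], so stabilization replaces it by some [g] killing [K] with the same values on
    [a]. Then [h1 + g] equals [i f] on [K] and [i e] on [a], and purity brings the finitely many
    values at [a] and [c] back to [N]. *)
Lemma pure_extension_step (A : set T) (f : F -> N) (a b c : seq T)
    (e : {linear F -> N}) : phi_closed A -> linear_on K f ->
  (forall s, rels K A s -> f s = 0) -> stabilizes K B A a b ->
  (forall x, gens A x -> e (gen x) = 0) ->
  (forall s, K s -> inr s \in b -> e s = f s) ->
  exists e' : {linear F -> N}, [/\ forall x, gens A x -> e' (gen x) = 0,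
    forall s, K s -> inr s \in c -> e' s = f s &
    forall x, inl x \in a -> e' (gen x) = e (gen x)].
Proof.
move=> A_closed f_lin fA st eA eb.
have if_lin : linear_on K (i \o f).
  by move=> u x y Kx Ky; rewrite /= f_lin // linearP.
have [|h1 [h1K h1A]] := phi_ext A_closed BC if_lin.
  by move=> s /fA /= ->; rewrite linear0.
have [||g [gK gA ga]] := st _ BC ((i \o e) \- h1).
- by move=> x Ax /=; rewrite eA // h1A // linear0 subrr.
- by move=> s Ks sb /=; rewrite eb // h1K // subrr.
pose h : {linear F -> C} := h1 \+ g.
pose eqs := [seq (gen x, e (gen x)) | x <- pmap (fun t : T =>
    if t is inl x then Some x else None) a] ++
  [seq (s, f s) | s <- pmap (fun t : T =>
    if t is inr s then if `[< K s >] then Some s else None else None) c].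
have [||e' [e'_eqs e'A]] :=
    @pure_free_extension R X N C i h eqs (gens A) i_pure.
- move=> [s n]; rewrite mem_cat => /orP[]/mapP[u + [-> ->]] /=.
    rewrite mem_pmap => /mapP[[x|//] xa [->]].
    by rewrite ga //= addrC subrK.
  rewrite mem_pmap => /mapP[[//|v] vc]; case: asboolP => // Kv [->].
  by rewrite h1K // gK // addr0.
- by move=> x Ax; rewrite /= h1A // gA // addr0.
exists e'; split=> // [s Ks sc|x xa].
  apply: (e'_eqs (s, f s)); rewrite mem_cat; apply/orP; right.
  apply/mapP; exists s => //; rewrite mem_pmap; apply/mapP; exists (inr s) => //.
  by case: asboolP.
apply: (e'_eqs (gen x, e (gen x))); rewrite mem_cat; apply/orP; left.
by apply/mapP; exists x => //; rewrite mem_pmap; apply/mapP; exists (inl x).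
Qed.

Lemma pure_extension_orbit (A : set T) (f : F -> N) (t : T) :
  phi_closed A -> linear_on K f -> (forall s, rels K A s -> f s = 0) ->
  exists e : {linear F -> N}, (forall x, gens A x -> e (gen x) = 0) /\
    forall s, rels K (orbit t) s -> e s = f s.
Proof.
move=> A_closed f_lin fA.
have A_gens := phi_closed_gens A_closed.
have [st stP] := choice (stabilizes_ex B_lim B_prod A_gens (phi_ext A_closed)).
(* Each list contains a stabilizing list for its predecessor, the predecessor itself, and one more
   generation of the orbit. *)
pose a := fix a n := if n is m.+1 then st (a m) ++ a m ++ generation t m else [::].
have a_st n : stabilizes K B A (a n) (a n.+1).
  by apply: (stabilizesS _ (stP (a n))) => u; rewrite mem_cat => ->.
have aS n : {subset a n <= a n.+1}.
  by move=> u un; rewrite !mem_cat un orbT.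
have a_gen n : {subset generation t n <= a n.+1}.
  by move=> u un; rewrite !mem_cat un !orbT.
have a_mono m n : (m <= n)%N -> {subset a m <= a n}.
  move=> /subnK <-; elim: (n - m)%N => [//|k IH] u um.
  by rewrite addSn; apply/aS/IH.
pose good n (e : {linear F -> N}) := (forall x, gens A x -> e (gen x) = 0) /\
  (forall s, K s -> inr s \in a n.+1 -> e s = f s).
(* With [a] and [b] empty, stabilization is witnessed by the zero map, so the step lemma also starts
   the construction. *)
have [|||e0 [e0A e0f _]] :=
    @pure_extension_step A f [::] [::] (a 1%N) \0 A_closed f_lin fA => //.
  by move=> D BD g gA _; exists \0; split.
have next n e : exists e', good n e ->
    good n.+1 e' /\ forall x, inl x \in a n -> e' (gen x) = e (gen x).
  have [[eA ef]|] := pselect (good n e); last by exists e.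
  have [e' [e'A e'f e'e]] :=
    pure_extension_step (a n.+2) A_closed f_lin fA (a_st n) eA ef.
  by exists e'.
have [nx nxP] := choice (fun p => next p.1 p.2 : exists e', good p.1 p.2 ->
  good p.1.+1 e' /\ forall x, inl x \in a p.1 -> e' (gen x) = p.2 (gen x)).
pose es := fix es n := if n is m.+1 then nx (m, es m) else e0.
have es_good n : good n (es n).
  by elim: n => [|n IH]; [split|case: (nxP (n, _) IH)].
have es_eq m n x : (m <= n)%N -> inl x \in a m -> es n (gen x) = es m (gen x).
  move=> le_mn xm; rewrite -(subnK le_mn); elim: (n - m)%N => [//|k IH].
  rewrite addSn -IH; apply: (nxP (_, _) (es_good _)).2.
  by apply: a_mono xm; apply: leq_addl.
(* Generators in [A] are set apart: their value is fixed to be 0. At any other generator the value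
   is constant from the first list containing it. *)
pose stage x n := ~ gens A x /\ inl x \in a n.
have e_ex x : exists y : N, (gens A x -> y = 0) /\
    forall n, stage x n -> y = es n (gen x).
  have [Ax|Ax] := pselect (gens A x); first by exists 0; split=> // n [].
  have [[n xn]|nx'] := pselect (exists n, inl x \in a n); last first.
    by exists 0; split=> // n [_ xn]; case: nx'; exists n.
  exists (es n (gen x)); split=> // m [_ xm].
  have [le_mn|/ltnW le_nm] := leqP m n; first exact: es_eq le_mn xm.
  by rewrite (es_eq _ _ _ le_nm xn).
have [y yP] := choice e_ex.
exists (free_lift y); split=> [x Ax|s [Ks [n sn]]] /=.
  by rewrite free_lift_gen (yP x).1.
(* The shift by 2 puts the generators of [s], which lie in generation [n.+1], into [a n.+2], where
   [es n.+2] already has its final values. *)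
have <- : es n.+2 s = f s by apply: (es_good n.+2).2 => //; exact/aS/aS/a_gen.
apply: (eq_linear_free (f := free_lift y)) => x xs.
rewrite -[LHS]/(free_lift y (gen x)) free_lift_gen.
have [Ax|Ax] := pselect (gens A x).
  by rewrite (yP x).1 // (es_good _).1.
apply: (yP x).2; split=> //; apply: a_gen.
by apply: generationS sn _; apply: phi_supp.
Qed.

(** Zorn's lemma on pairs of a closed set and values at generators that solve the problem for the
    relations in the set. If a maximal pair missed [t], the remaining error would vanish on the
    relations in [A], and a correction along the orbit of [t] would enlarge the pair. *)
Lemma pure_extension : extends_from K N.
Proof.
move=> f f_lin.
pose partial := {Ah : set T * (X -> N) | phi_closed Ah.1 /\
  forall s, rels K Ah.1 s -> free_lift Ah.2 s = f s}.
(* Values outside the closed set are junk and are not compared, so this is only a preorder. *)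
pose le (p q : partial) := `[< (sval p).1 `<=` (sval q).1 /\
  forall x, gens (sval p).1 x -> (sval p).2 x = (sval q).2 x >].
have p0 : partial.
  by exists (set0, fun=> 0); split=> [t u []|s [_ []]].
have [| | |[[A h] [/= A_closed hA]] A_max] := @ZL_preorder _ p0 le.
- by move=> p; apply/asboolP; split.
- move=> q p r /asboolP[pq pq'] /asboolP[qr qr']; apply/asboolP.
  split; first exact: subset_trans qr.
  by move=> x px; rewrite pq' // qr' //; apply: pq.
- move=> Ch Ch_tot.
  pose A : set T := fun t => exists2 p, Ch p & (sval p).1 t.
  have h_ex x : exists y : N, forall p, Ch p -> gens (sval p).1 x -> y = (sval p).2 x.
    have [[p Chp px]|np] := pselect (exists2 p, Ch p & gens (sval p).1 x); last first.
      by exists 0 => p Chp px; case: np; exists p.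
    exists ((sval p).2 x) => q Chq qx.
    by case: (Ch_tot _ _ Chp Chq) => /asboolP[_ ->].
  have [h hP] := choice h_ex.
  have A_closed : phi_closed A.
    by move=> t u [p Chp pt] ut; exists p => //; apply: (svalP p).1 ut.
  have hA s : rels K A s -> free_lift h s = f s.
    move=> [Ks [p Chp ps]]; rewrite -((svalP p).2 s); last by split.
    apply: (eq_linear_free (f := free_lift h) (g := free_lift _)) => x xs /=.
    rewrite !free_lift_gen; apply: hP => //.
    by apply: (phi_closed_gens (svalP p).1) xs; split.
  exists (exist _ (A, h) (conj A_closed hA)) => p Chp; apply/asboolP; split=> /=.
    by move=> t pt; exists p.
  by move=> x px; symmetry; apply: hP.
have A_gens := phi_closed_gens A_closed.
suff A_all t : A t by exists (free_lift h) => s Ks; apply: (hA s).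
have f'_lin := linear_on_sub (free_lift h) f_lin.
have [|e [eA ef]] := @pure_extension_orbit A _ t A_closed f'_lin.
  by move=> s /hA /= ->; rewrite subrr.
pose h' x := h x + e (gen x).
have h'E s : free_lift h' s = free_lift h s + e s.
  apply: (eq_linear_free (f := free_lift h') (g := free_lift h \+ e)) => x _ /=.
  by rewrite !free_lift_gen.
have A'_closed := phi_closedU A_closed (orbit_closed (t := t)).
have h'A s : rels K (A `|` orbit t) s -> free_lift h' s = f s.
  (* A relation in the union lies in one of the two sets. On those in [A] the correction vanishes;
     on those in the orbit it supplies exactly the error. *)
  move=> [Ks [As|ts]]; rewrite h'E.
    by rewrite (rels_vanish A_gens eA) // addr0 hA.
  by rewrite ef // addrC subrK.
pose q : partial := exist _ (A `|` orbit t, h') (conj A'_closed h'A).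
have le_q : le (exist _ (A, h) (conj A_closed hA)) q.
  apply/asboolP; split=> [u|x Ax] /=; first by left.
  by rewrite /h' eA // addr0.
have /asboolP[/= A'A _] := A_max q le_q.
by apply: A'A; right; apply: orbit_id.
Qed.

End PureExtension.

(** * Cardinals *)

(** Injections as relations can be restricted, inverted and glued without choosing values outside
    the domain. *)
Lemma card_leR T U (A : set T) (B : set U) : A #<= B <->
  exists G : T -> U -> Prop, [/\ forall x, A x -> exists2 y, B y & G x y,
    forall x x' y, G x y -> G x' y -> x = x' &
    forall x y y', G x y -> G x y' -> y = y'].
Proof.
split=> [/card_leP/injfunPex[f _ f_inj]|[G [G_ex G_inj _]]].
  exists (fun x y => exists2 z : A, val z = x & val (f z) = y); split.
  - move=> x Ax; exists (val (f (SigSub (mem_set Ax)))); first exact/set_mem/valP.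
    by exists (SigSub (mem_set Ax)).
  - move=> _ _ y [z <- <-] [z' <- /val_inj zz']; congr val.
    by apply: f_inj; rewrite ?inE.
  - by move=> x y y' [z <- <-] [z' /val_inj -> <-].
have ex (x : A) : exists y : B, G (val x) (val y).
  have [y By Gxy] := G_ex _ (set_mem (valP x)).
  by exists (SigSub (mem_set By)).
have [f fP] := choice ex; apply/card_leP/injfunPex; exists f => // x x' _ _ fxx'.
by apply/val_inj/(G_inj _ _ (val (f x))) => //; rewrite fxx'.
Qed.

(** A maximal partial bijection exhausts [A] or [B], since otherwise a pair of missed elements could
    be added to it. *)
Lemma card_le_total T U (A : set T) (B : set U) : A #<= B \/ B #<= A.
Proof.
pose P (G : set (T * U)) := [/\ forall x y, G (x, y) -> A x /\ B y,
  forall x x' y, G (x, y) -> G (x', y) -> x = x' &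
  forall x y y', G (x, y) -> G (x, y') -> y = y'].
have [Fs FsP Fs_tot|G [[GAB G_inj G_fun] G_max]] := @Zorn_bigcup _ P.
  have join p q : (\bigcup_(G in Fs) G) p -> (\bigcup_(G in Fs) G) q ->
      exists G, [/\ P G, G p & G q].
    move=> [G FG Gp] [H FH Hq].
    have [GH|HG] := Fs_tot _ _ FG FH; first by exists H; split; [apply: FsP|apply: GH|].
    by exists G; split; [apply: FsP| |apply: HG].
  split=> [x y xy|x x' y xy x'y|x y y' xy xy'].
  - by have [G [[GAB _ _] Gxy _]] := join _ _ xy xy; apply: GAB.
  - by have [G [[_ G_inj _] /G_inj Gxy /Gxy]] := join _ _ xy x'y.
  - by have [G [[_ _ G_fun] /G_fun Gxy /Gxy]] := join _ _ xy xy'.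
have [GA|/existsNP[a /not_implyP[Aa nGa]]] :=
    pselect (forall x, A x -> exists y, G (x, y)).
  left; apply/card_leR; exists (fun x y => G (x, y)); split=> // x /GA[y Gxy].
  by exists y => //; case: (GAB _ _ Gxy).
have [GB|/existsNP[b /not_implyP[Bb nGb]]] :=
    pselect (forall y, B y -> exists x, G (x, y)).
  right; apply/card_leR; exists (fun y x => G (x, y)); split=> // [y /GB[x Gxy]||].
  - by exists x => //; case: (GAB _ _ Gxy).
  - by move=> y y' x; apply: G_fun.
  - by move=> y x x'; apply: G_inj.
have GabP : P (G `|` [set (a, b)]).
  split=> [x y [/GAB//|[-> ->]]//|x x' y|x y y'].
    move=> [Gxy|/pair_equal_spec[xa yb]] [Gx'y|/pair_equal_spec[x'a yb']].
    - exact: G_inj Gx'y.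
    - by case: nGb; exists x; rewrite -yb'.
    - by case: nGb; exists x'; rewrite -yb.
    - by rewrite xa.
  move=> [Gxy|/pair_equal_spec[xa yb]] [Gxy'|/pair_equal_spec[xa' y'b]].
  - exact: G_fun Gxy'.
  - by case: nGa; exists y; rewrite -xa'.
  - by case: nGa; exists y'; rewrite -xa.
  - by rewrite yb.
case: (G_max _ _ GabP); split; first by move=> x Gx; left.
by move=> /(_ (a, b)) Gab; case: nGa; exists b; apply: Gab; right.
Qed.

Lemma card_lt_le T U V (A : set T) (A' : set U) (B : set V) :
  A' #<= A -> card_lt A B -> card_lt A' B.
Proof.
move=> A'A [AB nBA]; split; first exact: card_le_trans AB.
by move=> BA'; apply: nBA; apply: card_le_trans A'A.
Qed.

Lemma inj_card_lt T U V (A : set T) (f : U -> T) (B : set V) :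
  injective f -> (forall x, A (f x)) -> card_lt A B -> card_lt [set: U] B.
Proof.
move=> f_inj fA; apply/card_lt_le/card_leR; exists (fun x y => f x = y); split.
- by move=> x _; exists (f x).
- by move=> x x' y <- /f_inj.
- by move=> x y y' <-.
Qed.

Section RegularCardinals.
Variable L : Type.
Hypotheses (L_reg : regular_cardinal L) (L_unc : uncountable_cardinal L).

(** Regularity speaks only of subsets of [L] indexed by subsets of [L]. An embedding [E] of [L] into
    the union, together with an embedding [G] of the index set into [L], pulls the union back to
    such a family covering [L]. *)
Lemma bigcup_card_lt (I T : Type) (J : set I) (A : I -> set T) :
  card_lt J [set: L] -> (forall i, J i -> card_lt (A i) [set: L]) ->
  card_lt (\bigcup_(i in J) A i) [set: L].
Proof.
move=> J_lt A_lt; suff nL : ~ ([set: L] #<= \bigcup_(i in J) A i).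
  by split=> //; case: (card_le_total (\bigcup_(i in J) A i) [set: L]).
move=> /card_leR[E [E_ex E_inj E_fun]].
have /card_leR[G [G_ex G_inj G_fun]] := J_lt.1.
pose J' : set L := fun l => exists2 i, J i & G i l.
pose A' l : set L := fun m => exists i t, [/\ J i, G i l, E m t & A i t].
apply: (L_reg.2 J' A') => [|l [i Ji Gil]|].
- apply: card_lt_le J_lt; apply/card_leR; exists (fun l i => G i l); split.
  + by move=> l [i]; exists i.
  + by move=> l l' i; apply: G_fun.
  + by move=> l i i'; apply: G_inj.
- apply: card_lt_le (A_lt i Ji); apply/card_leR; exists E; split=> // m.
  by move=> [j [t [Jj Gjl Emt At]]]; exists t => //; rewrite (G_inj _ _ _ Gil Gjl).
apply/seteqP; split=> // m _; have [t [i Ji At] Emt] := E_ex m Logic.I.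
by have [l _ Gil] := G_ex _ Ji; exists l; [exists i|exists i, t].
Qed.

Lemma countable_card_lt T (A : set T) : countable A -> card_lt A [set: L].
Proof.
move=> A_count; split.
  by apply: card_le_trans A_count _; apply/infiniteP; case: L_reg.
by move=> LA; apply: L_unc; apply: card_le_trans A_count.
Qed.

Lemma setU_card_lt T (A A' : set T) :
  card_lt A [set: L] -> card_lt A' [set: L] -> card_lt (A `|` A') [set: L].
Proof.
move=> A_lt A'_lt; pose D (b : bool) := if b then A else A'.
apply: (@card_lt_le _ _ _ (\bigcup_(b in [set: bool]) D b)).
  by apply: subset_card_le => t [At|A't]; [exists true|exists false].
by apply: bigcup_card_lt => [|[]] //; apply: countable_card_lt; apply: countableP.
Qed.

End RegularCardinals.

(** * Modules presented by sets of generators and relations *)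

Section Subpresentations.
Variables (R : pzRingType) (X : choiceType) (K : submodule (free R^c X)).
Local Notation F := (free R^c X).
Local Notation T := (X + F)%type.

(** The projection of [F] onto the free part generated by [gens A]. It lets all presented modules be
    quotients of the same [F]. *)
Definition restrict (A : set T) : {linear F -> F} :=
  free_lift (fun x => if pselect (gens A x) is left _ then gen x else 0).

Lemma restrict_gen A x : gens A x -> restrict A (gen x) = gen x.
Proof. by move=> Ax; rewrite /restrict /= free_lift_gen; case: pselect. Qed.

Lemma restrict_gen0 A x : ~ gens A x -> restrict A (gen x) = 0.
Proof. by move=> Ax; rewrite /restrict /= free_lift_gen; case: pselect. Qed.

Lemma restrict_id A v : (forall x, x \in supp v -> gens A x) -> restrict A v = v.
Proof.
move=> vA; apply: (eq_linear_free (g := idfun)) => x /vA.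
exact: restrict_gen.
Qed.

Lemma restrictS A A' v : A `<=` A' -> restrict A' (restrict A v) = restrict A v.
Proof.
move=> AA'; apply: (eq_linear_free (f := restrict A' \o restrict A)) => x _ /=.
have [Ax|Ax] := pselect (gens A x).
  by rewrite (restrict_gen Ax) restrict_gen //; apply: AA'.
by rewrite (restrict_gen0 Ax) linear0.
Qed.

(* [F / presrel A] is the module with generators [gens A] and relations [rels A];
   the generators outside [A] are sent to 0. *)
Definition presrel A : submodule F :=
  preim_submodule (restrict A) (span (rels K A)).

Definition presented A : rmodType R := quot (presrel A).

Lemma presrel_restrict A v : presrel A (v - restrict A v).
Proof. by rewrite /= linearB restrictS // subrr => U _; apply: submodule0. Qed.

Lemma coset_restrict A v : coset (presrel A) (restrict A v) = coset (presrel A) v.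
Proof. exact/esym/cosetP/presrel_restrict. Qed.

Lemma rels_restrict A s : has_gens K A -> rels K A s -> restrict A s = s.
Proof. by move=> A_gens As; apply: restrict_id => x; apply: A_gens. Qed.

Lemma span_rels_restrict A s :
  has_gens K A -> span (rels K A) s -> restrict A s = s.
Proof.
move=> A_gens; apply: (linear_on_span (U := span (rels K A)) (g := idfun)).
- exact: span_sub.
- exact: linear_on_linear.
- by [].
by move=> x; apply: rels_restrict.
Qed.

Lemma span_rels_presrel A s :
  has_gens K A -> span (rels K A) s -> presrel A s.
Proof. by move=> A_gens As; rewrite /= (span_rels_restrict A_gens). Qed.

Lemma span_relsS A A' s :
  A `<=` A' -> span (rels K A) s -> span (rels K A') s.
Proof.
move=> AA'; apply: span_min => x [Kx Ax].
by apply: span_sub; split=> //; apply: AA'.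
Qed.

Lemma span_rels_sub A s : span (rels K A) s -> K s.
Proof. by apply: span_min => x []. Qed.

Lemma presented_map_ex A A' : A `<=` A' ->
  exists g : {linear presented A -> presented A'},
    forall v, g (coset _ v) = coset _ (restrict A v).
Proof.
move=> AA'; apply: (quot_lift (f := coset (presrel A') \o restrict A)) => v Av /=.
by apply/coset_eq0; rewrite /= restrictS //; apply: span_relsS Av.
Qed.

Definition presented_map A A' (AA' : A `<=` A') :
  {linear presented A -> presented A'} := projT1 (cid (presented_map_ex AA')).

Lemma presented_mapE A A' (AA' : A `<=` A') v :
  presented_map AA' (coset _ v) = coset _ (restrict A v).
Proof. exact: (projT2 (cid (presented_map_ex AA'))). Qed.

Section System.
Variable P : set (set T).

Definition presented_obj (A : subsets P) : rmodType R := presented (sval A).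

Definition presented_sys_map (A A' : subsets P) (le_AA' : (A <= A')%O) :
    {linear presented_obj A -> presented_obj A'} :=
  presented_map ((subsets_leP A A').1 le_AA').

Fact presented_sys_map_id (A : subsets P) (le_AA : (A <= A)%O) x :
  presented_sys_map le_AA x = x.
Proof.
by have [v <-] := coset_surj x; rewrite [LHS]presented_mapE coset_restrict.
Qed.

Fact presented_sys_map_comp (A B C : subsets P) (le_AB : (A <= B)%O) (le_BC : (B <= C)%O)
    (le_AC : (A <= C)%O) x :
  presented_sys_map le_BC (presented_sys_map le_AB x) = presented_sys_map le_AC x.
Proof.
have [v <-] := coset_surj x; rewrite [RHS]presented_mapE.
rewrite /presented_sys_map !presented_mapE restrictS //.
exact/subsets_leP.
Qed.

Definition presented_system : @poset_system R _ (subsets P) :=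
  PosetSystem presented_sys_map_id presented_sys_map_comp.

Hypothesis P_gens : forall A, P A -> has_gens K A.

(** A module presented by a directed union is the colimit of the modules presented by its members,
    as each generator and each relation appears at some stage. Leaving [N] and [q] general covers
    both the suprema of chains and the limit [M]. *)
Lemma presented_colimit (J : set (subsets P)) (N : rmodType R)
    (q : {linear F -> N})
    (c : forall A, J A -> {linear presented_system A -> N}) :
  let D := \bigcup_(A in J) sval A in
  (forall A B, J A -> J B -> exists2 C, J C & (A <= C)%O /\ (B <= C)%O) ->
  is_surjective q -> (forall v, q v = 0 <-> presrel D v) ->
  (forall A (JA : J A) v, c A JA (coset _ v) = q (restrict (sval A) v)) ->
  is_colimit c.
Proof.
move=> D J_dir q_surj q_ker cE.
have qD v : q (restrict D v) = q v.
  apply/eqP; rewrite -subr_eq0 -linearB; apply/eqP/q_ker.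
  rewrite -opprB; exact/submoduleN/presrel_restrict.
have JD A : J A -> sval A `<=` D by move=> JA t At; exists A.
have coset_gen0 A x : ~ gens A x -> coset (presrel A) (gen x) = 0.
  by move=> Ax; rewrite -coset_restrict restrict_gen0 // linear0.
split=> [A B JA JB le_AB x|N' g g_cocone].
  have [v <-] := coset_surj x; rewrite [sys_map _ _ _]presented_mapE !cE restrictS //.
  exact/subsets_leP.
(* Directedness makes the value independent of the stage; generators outside the union go to 0, as
   they do in [N]. *)
have g_ex x : exists y : N', (forall A (JA : J A), gens (sval A) x ->
    y = g A JA (coset _ (gen x))) /\ (~ gens D x -> y = 0).
  have [[A [JA Ax]]|nx] := pselect (exists A, J A /\ gens (sval A) x); last first.
    by exists 0; split=> // A JA Ax; case: nx; exists A.
  exists (g A JA (coset _ (gen x))); split=> [B JB Bx|[]]; last by exists A.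
  have [C JC [le_AC le_BC]] := J_dir A B JA JB.
  rewrite -(g_cocone A C JA JC le_AC) -(g_cocone B C JB JC le_BC).
  congr (g C JC _); rewrite [LHS]presented_mapE [RHS]presented_mapE.
  by rewrite !restrict_gen.
have [y yP] := choice g_ex.
pose h0 : {linear F -> N'} := free_lift y.
have h0E A (JA : J A) v : h0 (restrict (sval A) v) = g A JA (coset _ v).
  apply: (eq_linear_free (f := h0 \o restrict (sval A))
    (g := g A JA \o coset _)) => x _ /=.
  have [Ax|Ax] := pselect (gens (sval A) x).
    by rewrite restrict_gen // /h0 /= free_lift_gen; apply: (yP x).1.
  by rewrite restrict_gen0 // coset_gen0 // !linear0.
have h0D v : h0 (restrict D v) = h0 v.
  apply: (eq_linear_free (f := h0 \o restrict D)) => x _ /=.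
  have [Dx|Dx] := pselect (gens D x); first by rewrite restrict_gen.
  by rewrite restrict_gen0 // linear0 /h0 /= free_lift_gen (yP x).2.
have h0_rels s : rels K D s -> h0 s = 0.
  move=> [Ks [A JA As]]; have As' : rels K (sval A) s by split.
  have A_gens := P_gens (subsetsP A).
  rewrite -(rels_restrict A_gens As') h0E; apply/eqP.
  suff -> : coset (presrel (sval A)) s = 0 by rewrite linear0.
  exact/coset_eq0/(span_rels_presrel A_gens)/span_sub.
have h0_ker v : q v = 0 -> h0 v = 0.
  move=> /q_ker Dv; rewrite -h0D.
  by move: Dv; apply: (span_min (U := ker_submodule h0)).
have [h hE] := factor_surj q_surj h0_ker.
exists h; split=> [A JA x|h' h'g z].
  by have [v <-] := coset_surj x; rewrite cE hE h0E.
have [v <-] := q_surj z; rewrite hE.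
apply: (eq_linear_free (f := h' \o q) (g := h0)) => x _ /=.
have [[A JA Ax]|Dx] := pselect (gens D x).
  by rewrite -(restrict_gen Ax) -(cE A JA) h'g -(h0E A JA).
rewrite -qD restrict_gen0 // !linear0 /h0 /= free_lift_gen.
by rewrite (yP x).2.
Qed.

End System.

(** The submodule [presrel A] is the direct sum of the span of the relations in [A] and the kernel
    of [restrict A]. The hypothesis handles the first summand; the second is already a direct
    summand of [F]. *)
Lemma presented_ext1 A (C : rmodType R) : has_gens K A ->
  extends_from (span (rels K A)) C -> Ext1_vanishes (presented A) C.
Proof.
move=> A_gens A_ext; apply: (@extends_ext1 _ _ _ _ (coset (presrel A))).
  exact: coset_surj.
move=> f f_ker; have f_lin : linear_on (presrel A) f.
  by move=> a x y Ax Ay; apply: f_ker; apply/coset_eq0.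
have [|h0 h0E] := A_ext f.
  by move=> a x y Ax Ay; apply: f_lin; apply: span_rels_presrel.
(* [f] is linear on all of [F] after the projection along the generators in [A]. *)
have f_compl_lin : linear (fun v => f (v - restrict A v)).
  move=> a x y; rewrite -f_lin; try exact: presrel_restrict.
  by congr f; rewrite linearP scalerBr opprD addrACA.
pose h : {linear F -> C} := (h0 \o restrict A) \+ linear_of f_compl_lin.
exists h => v /coset_eq0 Av; rewrite /h /= h0E; last exact: Av.
have rAv : presrel A (restrict A v) by rewrite /= restrictS.
rewrite -(linear_onD f_lin rAv (presrel_restrict v)); congr f.
by rewrite addrC subrK.
Qed.

(** The presentation uses the free modules on the generators and on the relations in [A], both of
    which inject into [A]. The map [rho] retracts [F] onto the first of them. *)
Lemma presented_presented_lt (L : Type) A : has_gens K A ->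
  card_lt A [set: L] -> presented_lt L (presented A).
Proof.
move=> A_gens A_lt.
pose Y := {x : X | `[< gens A x >]}; pose S := {s : F | `[< rels K A s >]}.
pose incl_gens : {linear free R^c Y -> F} := free_lift (fun y : Y => gen (sval y)).
pose rho : {linear F -> free R^c Y} := free_lift (fun x =>
  if pselect (gens A x) is left Ax then gen (exist _ x (asboolT Ax) : Y) else 0).
have rhoE v : incl_gens (rho v) = restrict A v.
  apply: (eq_linear_free (f := incl_gens \o rho)) => x _.
  rewrite /incl_gens /rho /= !free_lift_gen.
  by case: pselect => Ax /=; rewrite ?free_lift_gen ?linear0.
have rhoK v : rho (incl_gens v) = v.
  apply: (eq_linear_free (f := rho \o incl_gens) (g := idfun)) => -[x xA] _.
  rewrite /incl_gens /rho /= !free_lift_gen; case: pselect => Ax /=.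
    by congr gen; apply: val_inj.
  by case: Ax; apply/asboolP.
pose p : {linear free R^c Y -> presented A} := coset (presrel A) \o incl_gens.
have p_rho v : p (rho v) = coset (presrel A) v.
  by rewrite /p /= rhoE coset_restrict.
pose f : {linear free R^c S -> free R^c Y} := free_lift (fun s : S => rho (sval s)).
exists (free R^c S), (free R^c Y), f, p; split.
- exists S, gen; split; first exact: free_basis.
  apply: (inj_card_lt (f := fun s : S => inr (sval s) : T)) A_lt.
    by move=> s s' [] /val_inj.
  by move=> [s /= /asboolP[]].
- exists Y, gen; split; first exact: free_basis.
  apply: (inj_card_lt (f := fun y : Y => inl (sval y) : T)) A_lt.
    by move=> y y' [] /val_inj.
  by move=> [y /= /asboolP].
- move=> y; split=> [/coset_eq0|[z <-]].
    (* The elements that [rho] sends into the image of [f] form a submodule containing the relations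
       in [A], hence their span. *)
    have im_submod : (exists z, f z = rho 0) /\
        forall a u v, (exists z, f z = rho u) -> (exists z, f z = rho v) ->
        exists z, f z = rho (a *: u + v).
      split=> [|a u v [z zu] [w wv]]; first by exists 0; rewrite !linear0.
      by exists (a *: z + w); rewrite !linearP zu wv.
    rewrite /= -rhoE rhoK => /(span_min (U := submodule_of im_submod)) [].
      move=> s As; exists (gen (exist _ s (asboolT As) : S)).
      by rewrite /f /= free_lift_gen.
    by move=> z; rewrite rhoK => <-; exists z.
  apply: (eq_linear_free (f := p \o f) (g := \0)) => -[s As] _.
  rewrite /f /= free_lift_gen -[LHS]/(p (rho s)) p_rho; apply/coset_eq0.
  apply: span_rels_presrel A_gens _; apply: span_sub; exact/asboolP.
by move=> z; have [v <-] := coset_surj z; exists (rho v); apply: p_rho.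
Qed.

End Subpresentations.

(** * The system of small closed subpresentations of a module *)

Section Main.
Variables (R : pzRingType) (B : rmodType R -> Prop).
Hypotheses (B_lim : closed_direct_limits B) (B_prod : closed_products B).
Variable M : rmodType R.
Hypothesis M_perp : left_perp B M.

Local Notation F := (free R^c M).
Local Notation T := (M + F)%type.
Let p : {linear F -> M} := free_lift id.
Let K : submodule F := ker_submodule p.

Let p_surj : is_surjective p.
Proof. by move=> x; exists (gen x); rewrite /p /= free_lift_gen. Qed.

Let K_ext C : B C -> extends_from K C.
Proof. by move=> BC; apply: ext1_extends => //; apply: M_perp. Qed.

(** The operators for relative extension and for orthogonality act on generators and on relations
    respectively, so they combine into one. Adding supports makes closed sets contain the generators
    of their relations. *)
Lemma finitary_closure_operator : exists phi : T -> seq T,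
  (forall s x, x \in supp s -> inl x \in phi (inr s)) /\
  forall A, phi_closed phi A -> forall C, B C ->
    relative_extension K A C /\ extends_from (span (rels K A)) C.
Proof.
have [phi1 phi1P] := closed_relative_extension B_lim B_prod K_ext.
have [phi2 phi2P] := closed_span_extension B_lim B_prod K_ext.
exists (fun t => match t with
  | inl x => phi1 x | inr s => map inl (supp s) ++ phi2 s end).
split=> [s x xs|A A_closed C BC]; first by rewrite mem_cat map_f.
split; [apply: phi1P BC => x t Ax tx|apply: phi2P BC => s t [_ As] ts].
  exact: A_closed Ax tx.
by apply: A_closed As _; rewrite mem_cat ts orbT.
Qed.

Lemma left_perp_pure_closure : left_perp (pure_closure B) M.
Proof.
move=> N [C [i [BC i_pure]]]; have [phi [phi_supp phiP]] := finitary_closure_operator.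
apply: extends_ext1 p_surj _.
apply: (pure_extension B_lim B_prod phi_supp) BC i_pure.
by move=> A A_closed D BD; case: (phiP A A_closed D BD).
Qed.

(** The index poset consists of the closed sets of size below [L]. Regularity keeps it stable under
    unions of fewer than [L] members, whence continuity; the countable orbits cover all generators
    and relations, whence the limit is [M]. *)
Lemma left_perp_class_projective (L : Type) :
  regular_cardinal L -> uncountable_cardinal L -> class_projective B L M.
Proof.
move=> L_reg L_unc; have [phi [phi_supp phiP]] := finitary_closure_operator.
pose P : set (set T) := fun A => phi_closed phi A /\ card_lt A [set: L].
have P_gens A : P A -> has_gens K A by move=> [Ac _]; apply: phi_closed_gens Ac.
have P_chain (J : set (subsets P)) :
    card_lt J [set: L] -> P (\bigcup_(A in J) sval A).
  move=> J_lt; split=> [t u [A JA At] ut|].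
    by exists A => //; apply: (subsetsP A).1 ut.
  by apply: bigcup_card_lt => // A _; case: (subsetsP A).
have P_orbit t : P (orbit phi t).
  split; first exact: orbit_closed.
  rewrite (_ : orbit phi t = \bigcup_(n in setT) [set` generation phi t n]).
    apply: countable_card_lt => //; apply: bigcup_countable => // n _.
    exact/finite_set_countable/finite_seq.
  by apply/seteqP; split=> u [n]; exists n.
have P_setU A A' : P A -> P A' -> P (A `|` A').
  move=> [Ac A_lt] [A'c A'_lt]; split; first exact: phi_closedU.
  exact: setU_card_lt.
pose S := presented_system K P.
have dir : directed_poset (subsets P).
  split; first exact/inhabits/(to_subsets (P_orbit (inl 0))).
  move=> A A'; exists (to_subsets (P_setU _ _ (subsetsP A) (subsetsP A'))).
  by split; apply/subsets_leP => t; [left|right].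
have c_ex (A : subsets P) : exists g : {linear S A -> M},
    forall v, g (coset _ v) = p (restrict (sval A) v).
  apply: (quot_lift (f := p \o restrict (sval A))) => v /= Av.
  exact: span_rels_sub Av.
have [c cE] := dependent_choice_fun c_ex.
exists _, (subsets P), S, c; split.
- split=> // J [J0 J_tot J_lt].
  have PD := P_chain J J_lt; pose D := to_subsets PD.
  have sup_D : supremums J D.
    split=> [A JA|D' D'_ub]; apply/subsets_leP => t; first by move=> At; exists A.
    by move=> [A JA At]; have /subsets_leP := D'_ub A JA; apply.
  exists D, sup_D; apply: (presented_colimit P_gens (q := coset (presrel K (sval D)))).
  + move=> A A' JA JA'; have [le_AA'|le_A'A] := J_tot A A' JA JA'.
      by exists A'.
    by exists A.
  + exact: coset_surj.
  + by move=> v; apply: coset_eq0.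
  + by move=> A JA v; apply: presented_mapE.
- move=> A; have [A_closed A_lt] := subsetsP A; have A_gens := P_gens _ (subsetsP A).
  split; first exact: presented_presented_lt.
  by move=> C BC; apply: presented_ext1 => //; case: (phiP _ A_closed C BC).
- apply: (presented_colimit P_gens (q := p)) => //.
  + move=> A A' _ _; have [C [le_AC le_A'C]] := dir.2 A A'; by exists C.
  have D_all t : (\bigcup_(A in [set: subsets P]) sval A) t.
    by exists (to_subsets (P_orbit t)) => //; apply: orbit_id.
  move=> v; rewrite /= restrict_id => [|x _]; last exact: D_all.
  split=> [pv|]; last exact: span_rels_sub.
  by apply: (span_sub (X := rels K _)); split=> //; apply: D_all.
- move=> A C BC g; have [A_closed _] := subsetsP A.
  have A_gens := P_gens _ (subsetsP A).
  pose f : {linear F -> C} := g \o coset (presrel K (sval A)).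
  have [fK _] := phiP _ A_closed C BC.
  have [||h [hK hA]] := fK f; first exact: linear_on_linear.
    move=> s As; rewrite /f /=; suff -> : coset (presrel K (sval A)) s = 0.
      by rewrite linear0.
    exact/coset_eq0/(span_rels_presrel A_gens)/span_sub.
  (* Since [f - h] kills [K], it descends to [M]; since [h] kills the generators in [A], the
     descended map still restricts to [g]. *)
  have [|k kE] := factor_surj (f := f \- h) p_surj.
    by move=> s ps; rewrite /= hK // subrr.
  exists k => x; have [v <-] := coset_surj x; rewrite cE kE /= coset_restrict.
  suff -> : h (restrict (sval A) v) = 0 by rewrite subr0.
  apply: (eq_linear_free (f := h \o restrict (sval A)) (g := \0)) => y _ /=.
  have [Ay|Ay] := pselect (gens (sval A) y).
    by rewrite restrict_gen // hA.
  by rewrite restrict_gen0 // linear0.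
Qed.

End Main.

Theorem theorem1p8 (R : pzRingType) (B : rmodType R -> Prop)
    (B_lim : closed_direct_limits B) (B_prod : closed_products B) :
  (forall M : rmodType R, left_perp B M ->
    forall L : Type, regular_cardinal L -> uncountable_cardinal L ->
      class_projective (definable_closure B) L M) /\
  (forall M : rmodType R,
    left_perp B M <-> left_perp (definable_closure B) M).
Proof.
have perp_closure M : left_perp B M -> left_perp (definable_closure B) M.
  move=> M_perp N /(definable_closure_pure B_lim B_prod).
  exact: left_perp_pure_closure.
split=> [M M_perp L L_reg L_unc|M].
  (* The definable closure is itself closed under products and direct limits, and [M] is orthogonal
     to it, so the construction is run with the closure in place of [B]. *)
  apply: left_perp_class_projective => //; last exact: perp_closure.
    exact: definable_closure_direct_limits.
  exact: definable_closure_products.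
split=> [|M_perp N BN]; first exact: perp_closure.
by apply: M_perp => D D_def; apply.
Qed.
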